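(* Let $t$ be a tree with $n$ vertices, let $\omega\in\mathbb{Z}_{>0}^n$ be a weight of length $n$, and let $P=P_{(t,\omega)}\subset\mathbb{R}^{n-1}$ be the Loday realization of the operahedron. Let $\vec v\in\mathbb{R}^{n-1}$ be a principal orientation vector, i.e. $\sum_{i\in I}v_i>\sum_{j\in J}v_j$ for all $(I,J)\in D(n-1)$. For $F,G$ two (nonempty) faces of $P$ with associated nestings $\mathcal{N}$ and $\mathcal{N}'$, we have $$(F,G)\in\operatorname{Im}\triangle_{(P,\vec v)}\iff\forall(I,J)\in D(n-1),\ \ \exists N\in\mathcal{N},\ |N\cap I|>|N\cap J|\ \text{ or }\ \exists N'\in\mathcal{N}',\ |N'\cap I|<|N'\cap J| .$$
   Context: $D(m)=\{(I,J)\,|\,I,J\subset\{1,\dots,m\},\ |I|=|J|,\ I\cap J=\emptyset,\ \min(I\cup J)\in I\}$ (so $I,J\ne\emptyset$). A tree with $n$ vertices is a planar rooted tree with $n$ internal vertices, each having at least one input. ''Vertices'' $V(t)$ and ''edges'' $E(t)$ always mean internal ones, so $|E(t)|=n-1$. Starting from the root, walk around the tree clockwise, numbering each vertex (resp. edge) the first time it is met; thus $V(t)=\{1,\dots,n\}$, $E(t)=\{1,\dots,n-1\}$. A nest is a nonempty $N\subset E(t)$ such that the graph formed by the edges of $N$ and their adjacent vertices is connected; $t(N)$ is the induced subtree with edges $N$ and vertices those adjacent to $N$. A nesting is a set $\mathcal{N}$ of nests containing the trivial nest $E(t)$, such that any two distinct nests are strictly nested or disjoint, and if disjoint then no edge of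 one is adjacent to an edge of the other. Maximal nestings are those of cardinality $n-1$; $\min\mathcal{N}(i)$ is the smallest nest of $\mathcal{N}$ containing the edge $i$. For a maximal nesting $\mathcal{N}$ and an edge $i$, cutting $t(\min\mathcal{N}(i))$ at $i$ gives two subtrees $t_1$ (with root $i$) and $t_2$ (with leaf $i$); put $\alpha_i=\sum_{j\in V(t_1)}\omega_j$, $\beta_i=\sum_{j\in V(t_2)}\omega_j$, $M(t,\mathcal{N},\omega)=(\alpha_1\beta_1,\dots,\alpha_{n-1}\beta_{n-1})$. Then $P_{(t,\omega)}=\operatorname{conv}\{M(t,\mathcal{N},\omega):\mathcal{N}\text{ maximal nesting}\}\subset\mathbb{R}^{n-1}$. (For $n=1$ it is the point $\mathbb{R}^0$, with the empty nesting.) Nonempty faces of $P_{(t,\omega)}$ correspond bijectively to nestings of $t$: the face associated with a nesting $\mathcal{N}$ is the convex hull of the $M(t,\mathcal{N}'',\omega)$ for maximal nestings $\mathcal{N}''\supset\mathcal{N}$. For a polytope $P$ and $z\in P$ put $\rho_zP=2z-P$. $P$ is positively oriented by $\vec v$ if for all $z\in P$, $\vec v$ is not perpendicular to any edge of $P\cap\rho_zP$; a principal orientation vector positively orients $P_{(t,\omega)}$. Then $\langle-,\vec v\rangle$ has a unique minimizer $\operatorname{bot}$ and a unique maximizer $\operatorname{top}$ on each $P\cap\rho_zP$, and $\triangle_{(P,\vec v)}:P\to P\times P$, $z\mapsto(\operatorname{bot}(P\cap\rho_zP),\operatorname{top}(P\cap\rho_zP))$. Its image is a union of faces of $P\times P$;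 ''$(F,G)\in\operatorname{Im}\triangle_{(P,\vec v)}$'' means $F\times G\subset\operatorname{Im}\triangle_{(P,\vec v)}$. *)

(* Defs.v *)
From mathcomp Require Import all_boot all_order all_algebra.
From mathcomp Require Import boolp classical_sets reals.

Set Implicit Arguments.
Unset Strict Implicit.
Unset Printing Implicit Defensive.

Import GRing.Theory Num.Theory.

(* All numberings start at 0 instead of 1: the root vertex is vertex 0. *)

(* Planar rooted trees: a vertex carries the list of its inputs from left to
   right, an input being a leaf (None) or an internal edge leading to the root
   vertex of a subtree (Some u).  Trees are required to satisfy [wf_tree]:
   every vertex has at least one input. *)
Inductive ptree : Type := Vertex of seq (option ptree).

Fixpoint wf_tree (t : ptree) : bool :=
  let: Vertex s := t in
  ~~ nilp s && all (fun x => if x is Some u then wf_tree u else true) s.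

Fixpoint nvertices (t : ptree) : nat :=
  let: Vertex s := t in
  (sumn (map (fun x => if x is Some u then nvertices u else 0) s)).+1.

(* A tree with n vertices has n - 1 internal edges. *)
Definition nedges (t : ptree) : nat := (nvertices t).-1.

(* [parents k t] lists, in the order of the clockwise walk around t, the lower
   end of every internal edge of t, the vertices of t being numbered by that
   walk from k (the root of t) on. *)
Fixpoint parents (k : nat) (t : ptree) : seq nat :=
  let: Vertex s := t in
  (fix inputs (next : nat) (s : seq (option ptree)) : seq nat :=
     match s with
     | [::] => [::]
     | None :: s' => inputs next s'
     | Some u :: s' =>
         k :: parents next u ++ inputs (next + nvertices u) s'
     end) k.+1 s.

Section Nestings.
Variable t : ptree.

Local Notation V := 'I_(nvertices t).
Local Notation E := 'I_(nedges t).

(* An edge is met just before its upper end, and every vertex but the root is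
   the upper end of exactly one edge: the upper end of edge e is e.+1. *)
Definition upper_end (e : E) (x : V) : bool := x == e.+1 :> nat.
Definition lower_end (e : E) (x : V) : bool := x == nth 0 (parents 0 t) e :> nat.

Definition incident (e : E) (x : V) : bool := upper_end e x || lower_end e x.

Definition adjacent_edges (e f : E) : bool :=
  [exists x, incident e x && incident f x].

Definition joined (N : {set E}) : rel V :=
  [rel x y | [exists e in N, incident e x && incident e y]].

Definition is_nest (N : {set E}) : bool :=
  (N != finset.set0) &&
  [forall x, forall y, [exists e in N, incident e x] ==>
     [exists e in N, incident e y] ==> connect (joined N) x y].

(* A tree with one vertex has no edge, hence no nest; its only nesting is the
   empty one. *)
Definition is_nesting (NN : {set {set E}}) : bool :=
  [&& [forall N in NN, is_nest N],
      (0 < nedges t) ==> ([set: E]%SET \in NN) &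
      [forall N1 in NN, forall N2 in NN, (N1 != N2) ==>
         [|| N1 \proper N2, N2 \proper N1 |
             [disjoint N1 & N2] &&
             [forall e in N1, forall f in N2, ~~ adjacent_edges e f]]]].

Definition max_nesting (NN : {set {set E}}) : bool :=
  is_nesting NN && (#|NN| == nedges t).

Definition min_nest (NN : {set {set E}}) (i : E) : {set E} :=
  [arg min_(N < [set: E]%SET | (N \in NN) && (i \in N)) #|N|].

(* Vertices of the two pieces of t(N) cut at i: the one above i, having i as
   its root, and the one below i, having i as a leaf. *)
Definition cut_above (N : {set E}) (i : E) : {set V} :=
  [set y | [exists x, upper_end i x && connect (joined (N :\ i)) x y]]%SET.
Definition cut_below (N : {set E}) (i : E) : {set V} :=
  [set y | [exists x, lower_end i x && connect (joined (N :\ i)) x y]]%SET.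

Variable w : V -> nat.

Definition alpha (NN : {set {set E}}) (i : E) : nat :=
  \sum_(x in cut_above (min_nest NN i) i) w x.
Definition beta (NN : {set {set E}}) (i : E) : nat :=
  \sum_(x in cut_below (min_nest NN i) i) w x.

End Nestings.

Definition Dset (m : nat) : {set {set 'I_m} * {set 'I_m}} :=
  [set IJ : {set 'I_m} * {set 'I_m} |
     [&& #|IJ.1| == #|IJ.2|, [disjoint IJ.1 & IJ.2] &
     [exists i in IJ.1, [forall k in IJ.1 :|: IJ.2, i <= k]]]]%SET.

Local Open Scope ring_scope.
Local Open Scope classical_set_scope.

Section Polytopes.
Variables (R : realType) (m : nat).
Implicit Types (P F : set 'rV[R]_m) (x y z v : 'rV[R]_m).

Definition dot x y : R := \sum_(i < m) x 0 i * y 0 i.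

Definition conv (I : finType) (S : {pred I}) (p : I -> 'rV[R]_m) :
    set 'rV[R]_m :=
  [set x | exists a : I -> R,
     [/\ forall i, i \in S -> 0 <= a i, \sum_(i in S) a i = 1 &
         x = \sum_(i in S) a i *: p i]].

(* Faces other than the empty one; P itself is obtained with c = 0. *)
Definition is_face P F : Prop :=
  F !=set0 /\
  exists c, F = [set x | P x /\ forall y, P y -> dot y c <= dot x c].

Definition reflection z P : set 'rV[R]_m := [set 2 *: z - x | x in P].

(* Some minimizer (resp. maximizer) of dot _ v on P, chosen classically (0 if
   there is none); on the intersections used below it is unique as
   soon as v positively orients the polytope. *)
Definition bot_point P v : 'rV[R]_m :=
  xget 0 [set x | P x /\ forall y, P y -> dot x v <= dot y v].
Definition top_point P v : 'rV[R]_m :=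
  xget 0 [set x | P x /\ forall y, P y -> dot y v <= dot x v].

Definition polytope_diagonal P v z : 'rV[R]_m * 'rV[R]_m :=
  (bot_point (P `&` reflection z P) v,
   top_point (P `&` reflection z P) v).

Definition principal_orientation v : Prop :=
  forall I J : {set 'I_m}, (I, J) \in Dset m ->
    \sum_(j in J) v 0 j < \sum_(i in I) v 0 i.

End Polytopes.

Section Operahedron.
Variables (R : realType) (t : ptree) (w : 'I_(nvertices t) -> nat).

Definition loday_point (NN : {set {set 'I_(nedges t)}}) : 'rV[R]_(nedges t) :=
  \row_i (alpha w NN i * beta w NN i)%:R.

Definition operahedron : set 'rV[R]_(nedges t) :=
  conv (@max_nesting t) loday_point.

Definition nesting_face (NN : {set {set 'I_(nedges t)}}) :
    set 'rV[R]_(nedges t) :=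
  conv [pred NN' | max_nesting NN' && (NN \subset NN')] loday_point.

End Operahedron.

Arguments loday_point R {t} w NN.
Arguments operahedron R {t} w.
Arguments nesting_face R {t} w NN.

(* Main.v *)
Require Import Defs.
From mathcomp Require Import all_boot all_order all_algebra.
From mathcomp Require Import boolp classical_sets reals.
From mathcomp Require Import zify ring lra.

(* The operahedron is cut out by [sum x = theta E] and [x(N) >= theta N] for the
   nests [N], where [theta N] is the total weight of the pairs of vertices whose
   path lies in [N]; by strict supermodularity of [theta], the inequalities that
   are tight at a point form a nesting.  For [x] in F and [y] in G, let [z] be
   their midpoint.  Then (x, y) is the image of [z] as soon as [<d, v> > 0] for
   all nonzero [d] with x + d and y - d in P.  Such [d] lie in the cone given by
   [d(E) = 0], [d(N) >= 0] for N in the first nesting and [d(N') <= 0] for N' in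
   the second one.  Two laminar families have a totally unimodular incidence
   matrix, so this cone is generated by vectors 1_J - 1_I with |I| = |J|, on
   which the sign of [<-, v>] is prescribed by the principal orientation: the
   condition on D(n-1) says exactly that no such vector is a descent direction.
   Conversely, at relative interior points of F and G a descent direction of
   this form is feasible, which contradicts minimality. *)

Set Implicit Arguments.
Unset Strict Implicit.
Unset Printing Implicit Defensive.

Import Order.TTheory GRing.Theory Num.Theory.

(** * Points of bounded polyhedra *)

Section Polyhedra.
Local Open Scope ring_scope.
Variables (R : realType) (m : nat).
Implicit Types (x y u v : 'rV[R]_m) (N I J : {set 'I_m}).

Lemma dotDl x y v : dot (x + y) v = dot x v + dot y v.
Proof. by rewrite -big_split; apply: eq_bigr => i _; rewrite mxE mulrDl. Qed.

Lemma dotZl (a : R) x v : dot (a *: x) v = a * dot x v.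
Proof. by rewrite mulr_sumr; apply: eq_bigr => i _; rewrite mxE mulrA. Qed.

Lemma dotNl x v : dot (- x) v = - dot x v.
Proof. by rewrite -scaleN1r dotZl mulN1r. Qed.

Lemma dot0l v : dot 0 v = 0.
Proof. by rewrite -(scale0r 0) dotZl mul0r. Qed.

Lemma dotBl x y v : dot (x - y) v = dot x v - dot y v.
Proof. by rewrite dotDl dotNl. Qed.

Lemma dotNr x v : dot x (- v) = - dot x v.
Proof. by rewrite -sumrN; apply: eq_bigr => i _; rewrite mxE mulrN. Qed.

Definition indicator N : 'rV[R]_m := \row_i (i \in N)%:R.

Lemma dot_indicator x N : dot x (indicator N) = \sum_(i in N) x 0 i.
Proof.
rewrite [RHS]big_mkcond; apply: eq_bigr => i _; rewrite mxE.
by case: (i \in N); rewrite ?mulr1 ?mulr0.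
Qed.

Lemma indicator_dot v N : dot (indicator N) v = \sum_(i in N) v 0 i.
Proof.
by rewrite -dot_indicator; apply: eq_bigr => i _; rewrite mulrC.
Qed.

Lemma dot_indicators I N : dot (indicator I) (indicator N) = #|N :&: I|%:R.
Proof.
rewrite indicator_dot -sum1_card natr_sum big_mkcond [RHS]big_mkcond.
apply: eq_bigr => i _; rewrite mxE inE andbC.
by case: (i \in I) => //; case: (i \in N).
Qed.

(** The matrix with the vectors of [s] as columns has [m] rows and rank at most [size s], so its
    left kernel is nonzero. *)
Lemma dot_kernel (s : seq 'rV[R]_m) : (size s < m)%N ->
  exists2 u, u != 0 & forall c, c \in s -> dot u c = 0.
Proof.
move=> lt_s; pose A : 'M[R]_(m, size s) := \matrix_(i, j) s`_j 0 i.
have kerA : kermx A != 0.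
  by rewrite kermx_eq0 /row_free neq_ltn (leq_ltn_trans (rank_leq_col A)).
exists (nz_row (kermx A)) => [|c /(nthP 0)[j lt_js <-]].
  by rewrite nz_row_eq0.
have /sub_kermxP/rowP/(_ (Ordinal lt_js)) := nz_row_sub (kermx A).
rewrite !mxE => eq0; rewrite -[RHS]eq0; apply: eq_bigr => i _.
by rewrite [A _ _]mxE.
Qed.

Lemma exists_minimizer (T : eqType) (f : T -> R) (s : seq T) : s != [::] ->
  exists2 k, k \in s & forall j, j \in s -> f k <= f j.
Proof.
elim: s => // a [|b s] IHs _.
  by exists a; rewrite ?mem_head // => j; rewrite inE => /eqP ->.
have [//|k ks mink] := IHs.
have [le_ak | lt_ka] := leP (f a) (f k).
  exists a; rewrite ?mem_head // => j; rewrite in_cons => /orP[/eqP -> //|js].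
  exact: le_trans (mink j js).
exists k; first by rewrite in_cons ks orbT.
move=> j; rewrite in_cons => /orP[/eqP ->|/mink //]; exact: ltW.
Qed.

(* A constraint [k] is a pair (normal vector, bound), read [k.2 <= <x, k.1>]. *)
Definition feasible (s : seq ('rV[R]_m * R)) x : Prop :=
  forall k, k \in s -> k.2 <= dot x k.1.

Definition convex_prop (S : 'rV[R]_m -> Prop) : Prop :=
  forall x y (a : R), 0 <= a -> a <= 1 -> S x -> S y ->
    S (a *: x + (1 - a) *: y).

(** The ratio test of the simplex method: the step is the least quotient of slack by rate of
    decrease, over the constraints that decrease along [u]. *)
Lemma feasible_hit s x u : feasible s x ->
    (forall k, k \in s -> dot x k.1 = k.2 -> 0 <= dot u k.1) ->
    (exists2 k, k \in s & dot u k.1 < 0) ->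
  exists a : R, [/\ 0 < a, feasible s (x + a *: u) &
    exists k, [/\ k \in s, dot u k.1 < 0 & dot (x + a *: u) k.1 = k.2]].
Proof.
move=> fx ux [k1 k1s k1neg].
pose ratio k := (dot x k.1 - k.2) / - dot u k.1.
have [|k0] := @exists_minimizer _ ratio [seq k <- s | dot u k.1 < 0].
  by rewrite -has_filter; apply/hasP; exists k1.
rewrite mem_filter => /andP[k0neg k0s] min0.
have slack k : k \in s -> dot u k.1 < 0 -> 0 < dot x k.1 - k.2.
  move=> ks kneg; rewrite subr_gt0 lt_neqAle fx // andbT eq_sym.
  by apply: contraTneq kneg => /ux; rewrite -leNgt; apply.
exists (ratio k0); split.
- by rewrite divr_gt0 ?oppr_gt0 ?slack.
- move=> k ks; rewrite dotDl dotZl.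
  have r0 : 0 < ratio k0 by rewrite divr_gt0 ?oppr_gt0 ?slack.
  have [kpos | kneg] := leP 0 (dot u k.1).
    have := fx k ks; nra.
  have: ratio k0 <= ratio k by apply: min0; rewrite mem_filter kneg.
  rewrite {2}/ratio ler_pdivlMr ?oppr_gt0 //; nra.
- exists k0; split=> //; rewrite dotDl dotZl /ratio; field.
  by rewrite lt_eqF.
Qed.

Lemma feasible_move s x u : feasible s x ->
    (forall k, k \in s -> dot x k.1 = k.2 -> 0 <= dot u k.1) ->
  exists2 a : R, 0 < a & feasible s (x + a *: u).
Proof.
move=> fx ux.
have [/(feasible_hit fx ux)[a [a0 fa _]] | noneg] :=
  pselect (exists2 k, k \in s & dot u k.1 < 0); first by exists a.
exists 1 => // k ks; rewrite scale1r dotDl.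
have := fx k ks; have [u0|uneg _] := leP 0 (dot u k.1); first by lra.
by case: noneg; exists k.
Qed.

Lemma count_ltn (T : eqType) (a b : pred T) (s : seq T) (k : T) :
    (forall j, j \in s -> b j -> a j) -> k \in s -> a k -> ~~ b k ->
  (count b s < count a s)%N.
Proof.
move=> ba ks ak bk; rewrite -!size_filter.
have -> : [seq j <- s | b j] = [seq j <- [seq j <- s | a j] | b j].
  rewrite -filter_predI; apply: eq_in_filter => j js /=.
  by case: (boolP (b j)) => // /(ba j js) ->.
rewrite size_filter -[ltnRHS](count_predC b) -[ltnLHS]addn0.
by rewrite ltn_add2l -has_count; apply/hasP; exists k; rewrite // mem_filter ak.
Qed.

(* A bounded polyhedron is the convex hull of its basic points, those at which
   the normal vectors of the tight constraints span the space. *)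
Lemma polyhedron_ind s (S : 'rV[R]_m -> Prop) :
    (forall u, (forall k, k \in s -> 0 <= dot u k.1) -> u = 0) ->
    convex_prop S ->
    (forall y, feasible s y ->
       (forall u, (forall k, k \in s -> dot y k.1 = k.2 -> dot u k.1 = 0) ->
          u = 0) -> S y) ->
  forall x, feasible s x -> S x.
Proof.
move=> bounded convS basic x.
(* Induction on the number of constraints that are not tight at [x]. *)
have [n] := ubnP (count (fun k => dot x k.1 != k.2) s).
elim: n x => // n IHn x; rewrite ltnS => le_n fx.
have [[u u0 ux]|nou] := pselect (exists2 u, u != 0 &
    forall k, k \in s -> dot x k.1 = k.2 -> dot u k.1 = 0); last first.
  apply: basic => // u ux; apply/eqP/negPn/negP => u0.
  by apply: nou; exists u.
(* A move along [u'] keeps the tight constraints tight; by boundedness it meets a new one, and the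
   induction hypothesis applies there. Doing so along [u] and [- u] places [x] on a segment between
   two points of [S]. *)
have hit u' : u' != 0 ->
    (forall k, k \in s -> dot x k.1 = k.2 -> dot u' k.1 = 0) ->
    exists2 a : R, 0 < a & S (x + a *: u').
  move=> u'0 u'x.
  have [||a [a0 fa [k [ks kneg ktight]]]] := @feasible_hit s x u' fx.
  - by move=> k ks /(u'x k ks) ->.
  - apply: contrapT => noneg; case/eqP: u'0; apply: bounded => k ks.
    by rewrite leNgt; apply/negP => kneg; apply: noneg; exists k.
  exists a => //; apply: IHn => //; apply: leq_trans le_n.
  apply: (count_ltn _ ks) => [j js||].
  - apply: contraNN => /eqP jx; rewrite dotDl dotZl u'x ?jx //.
    by rewrite mulr0 addr0.
  - by apply: contraTN kneg => /eqP /(u'x k ks) ->; rewrite ltxx.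
  - by rewrite ktight eqxx.
have [a a0 Sa] := hit u u0 ux.
have [||b b0 Sb] := hit (- u).
- by rewrite oppr_eq0.
- by move=> k ks /(ux k ks); rewrite dotNl => ->; rewrite oppr0.
have ab0 : 0 < a + b by lra.
have -> : x = (b / (a + b)) *: (x + a *: u)
              + (1 - b / (a + b)) *: (x + b *: - u).
  apply/rowP => i; rewrite !mxE; field; lra.
apply: convS => //; first by rewrite divr_ge0 // ltW.
by rewrite ler_pdivrMr // mul1r; lra.
Qed.

End Polyhedra.

(** * Two laminar families *)

Section Laminar.
Local Open Scope ring_scope.
Variable T : finType.
Implicit Types (L : {set {set T}}) (M N : {set T}).

Definition laminar L : Prop :=
  forall M N i, M \in L -> N \in L -> i \in M -> i \in N ->
    (M \subset N) || (N \subset M).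

(** The same expression as [min_nest], so that the lemmas below apply to [min_nest] by
    conversion. *)
Definition least L (i : T) : {set T} :=
  [arg min_(N < [set: T]%SET | (N \in L) && (i \in N)) #|N|]%N.

Variable L : {set {set T}}.
Hypotheses (lamL : laminar L) (topL : [set: T]%SET \in L).

Lemma least_spec i : [/\ least L i \in L, i \in least L i &
  forall N, N \in L -> i \in N -> least L i \subset N].
Proof.
rewrite /least; case: arg_minnP => [|M /andP[ML iM] minM].
  by rewrite topL inE.
split=> // N NL iN; have /orP[//|NM] := lamL ML NL iM iN.
by rewrite -(geq_leqif (subset_leqif_card NM)) minM // NL.
Qed.

Lemma least_in i : least L i \in L. Proof. by case: (least_spec i). Qed.

Lemma mem_least i : i \in least L i. Proof. by case: (least_spec i). Qed.

Lemma least_sub i N : N \in L -> i \in N -> least L i \subset N.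
Proof. by case: (least_spec i) => _ _; apply. Qed.

End Laminar.

(** * Integrality and sign vectors for two laminar families *)

Section TwoLaminar.
Local Open Scope ring_scope.
Variables (R : realType) (m : nat).
Implicit Types (u y v : 'rV[R]_m) (L : {set {set 'I_m}}) (N : {set 'I_m}).

(** The fibres of [least L] partition the ground set, and [N] is the union of those over the members
    of [L] inside [N]. *)
Lemma laminar_sum L u N : laminar L -> [set: 'I_m]%SET \in L -> N \in L ->
  \sum_(i in N) u 0 i =
  \sum_(M in L | M \subset N) \sum_(i | least L i == M) u 0 i.
Proof.
move=> lamL topL NL.
rewrite (partition_big (least L) [pred M | (M \in L) && (M \subset N)]) /=.
  apply: eq_bigr => M /andP[ML MN]; apply: eq_bigl => i.
  rewrite andb_idl // => /eqP leM; apply: (fintype.subsetP MN).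
  by rewrite -leM mem_least.
by move=> i iN; rewrite least_in ?least_sub.
Qed.

(** Induction on the size of [N]: the sum over a fibre is the sum over [N] minus those over the
    fibres of smaller members. *)
Lemma laminar_int L y : laminar L -> [set: 'I_m]%SET \in L ->
    (forall N, N \in L -> \sum_(i in N) y 0 i \is a Num.int) ->
  forall N, \sum_(i | least L i == N) y 0 i \is a Num.int.
Proof.
move=> lamL topL inty N; have [n] := ubnP #|N|; elim: n N => // n IHn N.
rewrite ltnS => leN; have [NL|NL] := boolP (N \in L); last first.
  rewrite big_pred0 ?rpred0 // => i; apply: contraNF NL => /eqP <-.
  exact: least_in.
have := inty N NL; rewrite (laminar_sum y lamL topL NL) (bigD1 N) ?NL //=.
rewrite rpredDr // rpred_sum // => M /andP[/andP[ML MN] neMN].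
apply: IHn; apply: leq_trans leN; apply: proper_card.
by rewrite finset.properEneq neMN.
Qed.

Lemma card_imset_double (K : finType) (f : 'I_m -> K) (D : {set 'I_m}) :
    (forall i, i \in D -> exists2 j, j \in D & (j != i) && (f j == f i)) ->
  (#|f @: D|.*2 <= #|D|)%N.
Proof.
move=> fD; rewrite -[leqRHS]sum1_card (partition_big_imset f) /=.
rewrite -muln2 -sum_nat_const; apply: leq_sum => _ /imsetP[i iD ->].
have [j jD /andP[neji /eqP fji]] := fD i iD.
rewrite (bigD1 i) ?iD ?eqxx //= (bigD1 j) ?jD ?fji ?eqxx //=.
Qed.

(* In the bipartite multigraph with an edge from [f i] to [g i] for each [i] in
   [D], all degrees are at least 2, so there are at most [#|D|] vertices; and
   one of the balance equations at the vertices follows from the others. *)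
Lemma balanced_kernel (K1 K2 : finType) (f : 'I_m -> K1) (g : 'I_m -> K2)
    (D : {set 'I_m}) : D != finset.set0 ->
    (forall i, i \in D -> exists2 j, j \in D & (j != i) && (f j == f i)) ->
    (forall i, i \in D -> exists2 j, j \in D & (j != i) && (g j == g i)) ->
  exists u, [/\ u != 0, forall i, i \notin D -> u 0 i = 0,
    forall k, \sum_(i | f i == k) u 0 i = 0 &
    forall k, \sum_(i | g i == k) u 0 i = 0].
Proof.
move=> /set0Pn[i0 i0D] /card_imset_double cf /card_imset_double cg.
pose fib (K : finType) (h : 'I_m -> K) k := indicator R [set i | h i == k]%SET.
have fibE (K : finType) (h : 'I_m -> K) u k :
    dot u (fib K h k) = \sum_(i | h i == k) u 0 i.
  by rewrite dot_indicator; apply: eq_bigl => i; rewrite inE.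
have g0 : g i0 \in g @: D by apply: imset_f.
(* Vanishing off [D], and balance at every vertex except [g i0]: fewer than [m] equations, since
   each image has at most half as many elements as [D]. *)
pose s := [seq indicator R [set i]%SET | i <- enum (~: D)]
  ++ [seq fib _ f k | k <- enum (f @: D)]
  ++ [seq fib _ g k | k <- enum ((g @: D) :\ g i0)].
have [|u u0 us] := @dot_kernel R m s.
  rewrite !size_cat !size_map -!cardE.
  have := cardsC D; rewrite card_ord.
  have := cardsD1 (g i0) (g @: D); rewrite g0; lia.
have uD i : i \notin D -> u 0 i = 0.
  move=> iD; have := us (indicator R [set i]%SET).
  rewrite dot_indicator big_set1 => -> //; rewrite mem_cat; apply/orP; left.
  by apply/mapP; exists i; rewrite // mem_enum inE.
have uf k : \sum_(i | f i == k) u 0 i = 0.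
  have [kD|kD] := boolP (k \in f @: D); last first.
    apply: big1 => i /eqP fi; apply: uD; apply: contraNN kD => iD.
    by rewrite -fi imset_f.
  rewrite -fibE us // !mem_cat; apply/or3P/Or32.
  by apply/mapP; exists k; rewrite ?mem_enum.
have ug k : k != g i0 -> \sum_(i | g i == k) u 0 i = 0.
  move=> kg; have [kD|kD] := boolP (k \in g @: D); last first.
    apply: big1 => i /eqP gi; apply: uD; apply: contraNN kD => iD.
    by rewrite -gi imset_f.
  rewrite -fibE us // !mem_cat; apply/or3P/Or33.
  by apply/mapP; exists k; rewrite // mem_enum in_setD1 kg.
exists u; split=> // k; have [->|/ug //] := eqVneq k (g i0).
have: \sum_i u 0 i = 0.
  by rewrite (partition_big f predT) //= big1 // => k' _; apply: uf.
rewrite (partition_big g predT) //= (bigD1 (g i0)) //=.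
by rewrite [X in _ + X]big1 ?addr0 // => k' /ug.
Qed.

(* A consequence of the total unimodularity of the incidence matrix of the union
   of two laminar families. *)
Lemma two_laminar_integral L1 L2 y :
    laminar L1 -> [set: 'I_m]%SET \in L1 ->
    laminar L2 -> [set: 'I_m]%SET \in L2 ->
    (forall N, N \in L1 -> \sum_(i in N) y 0 i \is a Num.int) ->
    (forall N, N \in L2 -> \sum_(i in N) y 0 i \is a Num.int) ->
    (forall u, (forall i, y 0 i \is a Num.int -> u 0 i = 0) ->
       (forall N, N \in L1 -> \sum_(i in N) u 0 i = 0) ->
       (forall N, N \in L2 -> \sum_(i in N) u 0 i = 0) -> u = 0) ->
  forall i, y 0 i \is a Num.int.
Proof.
move=> lam1 top1 lam2 top2 int1 int2 ker.
pose D := [set i | y 0 i \isn't a Num.int]%SET.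
(* The sum of [y] over a fibre of [least L] is an integer, so a fibre cannot contain exactly one
   non-integral coordinate. *)
have partner L : laminar L -> [set: 'I_m]%SET \in L ->
    (forall N, N \in L -> \sum_(i in N) y 0 i \is a Num.int) ->
    forall i, i \in D ->
      exists2 j, j \in D & (j != i) && (least L j == least L i).
  move=> lamL topL intL i iD; apply: contrapT => noj.
  have := laminar_int lamL topL intL (least L i).
  rewrite (bigD1 i) //= rpredDr; first by move: iD; rewrite inE => /negP.
  rewrite rpred_sum // => j /andP[ji neji]; apply: contrapT => /negP jD.
  by apply: noj; exists j; rewrite ?inE // neji.
have [D0|] := eqVneq D finset.set0.
  move=> i; apply: contrapT => /negP iD; have: i \in D by rewrite inE.
  by rewrite D0 inE.
case/balanced_kernel/(_ (partner _ lam1 top1 int1) (partner _ lam2 top2 int2)).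
move=> u [u0 uD u1 u2] i; case/eqP: u0; apply: ker.
- by move=> j yj; apply: uD; rewrite inE yj.
- move=> N NL; rewrite (laminar_sum u lam1 top1 NL) big1 // => M _.
  exact: u1.
- move=> N NL; rewrite (laminar_sum u lam2 top2 NL) big1 // => M _.
  exact: u2.
Qed.

(** The smallest index [k] of the support decides. If [y] is -1 there, [(I, J)] is in [Dset]; if it
    is 1, then [(J, I)] is, and the orientation of [v] makes [dot y v] positive. *)
Lemma sign_vector_Dset v y : principal_orientation v ->
    (forall i, y 0 i \is a Num.int) -> (forall i, -1 <= y 0 i <= 1) ->
    \sum_i y 0 i = 0 -> y != 0 -> dot y v <= 0 ->
  exists I J, (I, J) \in Dset m /\ y = indicator R J - indicator R I.
Proof.
move=> hv inty boxy sumy y0 yv.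
pose I := [set i | y 0 i == -1]%SET; pose J := [set i | y 0 i == 1]%SET.
have neq11 : (-1 : R) != 1 by apply/eqP; lra.
have yE : y = indicator R J - indicator R I.
  apply/rowP => i; rewrite !mxE !inE.
  have /intrP[z yz] := inty i; have := boxy i; rewrite yz.
  rewrite -[-1]/((-1)%:~R) -[1]/(1%:~R) !ler_int !eqr_int => /andP[z1 z2].
  have [->|[->|->]] : z = -1 \/ z = 0 \/ z = 1 by lia.
  - by rewrite /= sub0r.
  - by rewrite /= subr0.
  - by rewrite /= subr0.
have disIJ : [disjoint I & J].
  apply/pred0P => i /=; rewrite !inE; apply/negP => /andP[/eqP -> /eqP e].
  by move: neq11; rewrite e eqxx.
have cardIJ : #|I| = #|J|.
  apply/eqP; rewrite -(eqr_nat R) -subr_eq0 -opprB oppr_eq0; apply/eqP.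
  rewrite -sumy -(finset.setTI I) -(finset.setTI J) -!dot_indicators.
  rewrite -dotBl -yE dot_indicator; apply: eq_bigl => i; rewrite inE.
  by [].
have [i0 i0IJ] : exists i, i \in I :|: J.
  apply/set0Pn; apply: contraNneq y0 => /eqP; rewrite finset.setU_eq0.
  move=> /andP[/eqP I0 /eqP J0]; rewrite yE I0 J0 subrr //.
have [k kIJ mink] := arg_minnP (fun i : 'I_m => i : nat) i0IJ.
have vE : dot y v = \sum_(j in J) v 0 j - \sum_(i in I) v 0 i.
  by rewrite yE dotBl !indicator_dot.
have /finset.setUP[kI|kJ] : k \in I :|: J := kIJ.
  exists I, J; split=> //; rewrite inE /= cardIJ eqxx disIJ /=.
  by apply/existsP; exists k; rewrite kI; apply/forall_inP => j /mink.
suff /hv : (J, I) \in Dset m by rewrite -subr_gt0 -vE ltNge yv.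
rewrite inE /= cardIJ eqxx disjoint_sym disIJ /=.
apply/existsP; exists k; rewrite kJ; apply/forall_inP => j.
by rewrite finset.setUC => /mink.
Qed.

(* Each normalized point of the cone is a convex combination of sign vectors
   of the cone, by total unimodularity. *)
Lemma laminar_cone v T1 T2 u : principal_orientation v ->
    laminar T1 -> laminar T2 -> u != 0 -> \sum_i u 0 i = 0 ->
    (forall N, N \in T1 -> 0 <= \sum_(i in N) u 0 i) ->
    (forall N, N \in T2 -> \sum_(i in N) u 0 i <= 0) ->
    dot u v <= 0 ->
  exists I J, [/\ (I, J) \in Dset m,
    forall N, N \in T1 -> (#|N :&: I| <= #|N :&: J|)%N &
    forall N, N \in T2 -> (#|N :&: J| <= #|N :&: I|)%N].
Proof.
move=> hv lam1 lam2 u0 sumu u1 u2 uv; apply: contrapT => noIJ.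
(* The cone is cut by the cube with coordinates between -1 and 1 to make it bounded; the equation on
   the total is a pair of opposite inequalities. *)
pose s : seq ('rV[R]_m * R) :=
  ([seq (indicator R N, 0) | N <- enum T1]
   ++ [seq (- indicator R N, 0) | N <- enum T2]
   ++ [:: (indicator R [set: 'I_m], 0); (- indicator R [set: 'I_m], 0)])
  ++ [seq (indicator R [set i]%SET, -1) | i <- enum 'I_m]
  ++ [seq (- indicator R [set i]%SET, -1) | i <- enum 'I_m].
pose cone y := [/\ forall N, N \in T1 -> 0 <= \sum_(i in N) y 0 i,
  forall N, N \in T2 -> \sum_(i in N) y 0 i <= 0 & \sum_i y 0 i = 0].
have sT1 N : N \in T1 -> (indicator R N, 0) \in s.
  move=> NT; rewrite !mem_cat; do 2 (apply/orP; left).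
  by apply/mapP; exists N; rewrite ?mem_enum.
have sT2 N : N \in T2 -> (- indicator R N, 0) \in s.
  move=> NT; rewrite !mem_cat; apply/orP; left; apply/orP; right.
  by apply/orP; left; apply/mapP; exists N; rewrite ?mem_enum.
have sE : (indicator R [set: 'I_m], 0) \in s.
  by rewrite !mem_cat !inE eqxx !orbT.
have sNE : (- indicator R [set: 'I_m], 0) \in s.
  by rewrite !mem_cat !inE eqxx !orbT.
have sp i : (indicator R [set i]%SET, -1) \in s.
  rewrite !mem_cat; apply/orP; right; apply/orP; left.
  by apply/mapP; exists i; rewrite ?mem_enum.
have sn i : (- indicator R [set i]%SET, -1) \in s.
  rewrite !mem_cat; apply/orP; right; apply/orP; right.
  by apply/mapP; exists i; rewrite ?mem_enum.
have sumT y : dot y (indicator R [set: 'I_m]) = \sum_i y 0 i.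
  by rewrite dot_indicator; apply: eq_bigl => i; rewrite inE.
have sum1 y i : dot y (indicator R [set i]%SET) = y 0 i.
  by rewrite dot_indicator big_set1.
have feasE y : feasible s y <-> cone y /\ forall i, -1 <= y 0 i <= 1.
  split=> [fy|[[y1 y2 sumy] boxy] k].
    split; [split|] => [N NT|N NT||i].
    - by have := fy _ (sT1 N NT); rewrite dot_indicator.
    - by have := fy _ (sT2 N NT); rewrite dotNr dot_indicator oppr_ge0.
    - apply/eqP; rewrite eq_le -oppr_ge0 -sumT -dotNr.
      by rewrite (fy _ sE) (fy _ sNE).
    - have := fy _ (sp i); have := fy _ (sn i); rewrite dotNr sum1 /= => h1 h2.
      by apply/andP; split; lra.
  rewrite !mem_cat -!orbA => /or4P[| | |].
  - by case/mapP => N; rewrite mem_enum => /y1 yN -> /=; rewrite dot_indicator.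
  - case/mapP => N; rewrite mem_enum => /y2 yN -> /=.
    by rewrite dotNr dot_indicator oppr_ge0.
  - by move=> /eqP -> /=; rewrite sumT sumy.
  case/or4P=> [/eqP ->|//|/mapP[i _ ->]|/mapP[i _ ->]] /=.
  - by rewrite dotNr sumT sumy oppr0.
  - by rewrite sum1; have /andP[] := boxy i.
  - by rewrite dotNr sum1 lerN2; have /andP[] := boxy i.
(* Division by the sum of the absolute values brings [u] into the cube. *)
pose c := \sum_i `|u 0 i|.
have c0 : 0 < c.
  rewrite lt_neqAle sumr_ge0 // andbT; apply: contra_neq u0 => c0.
  apply/rowP => i; rewrite mxE; apply/eqP; rewrite -normr_eq0.
  by rewrite (psumr_eq0P _ (esym c0)).
suff: c^-1 *: u = 0 \/ 0 < dot (c^-1 *: u) v.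
  case=> [/eqP|]; first by rewrite scaler_eq0 invr_eq0 gt_eqF // (negPf u0).
  by rewrite dotZl pmulr_rgt0 ?invr_gt0 // ltNge uv.
apply: (@polyhedron_ind _ _ s (fun y => y = 0 \/ 0 < dot y v)).
- move=> y ys; apply/rowP => i; rewrite mxE.
  have := ys _ (sp i); have := ys _ (sn i); rewrite dotNr sum1 /=; lra.
- move=> x y a a0 a1 [->|xv] [->|yv].
  + by left; rewrite !scaler0 addr0.
  + rewrite scaler0 add0r; have [->|na] := eqVneq a 1.
      by left; rewrite subrr scale0r.
    by right; rewrite dotZl mulr_gt0 // subr_gt0 lt_neqAle na.
  + rewrite scaler0 addr0; have [->|na] := eqVneq a 0.
      by left; rewrite scale0r.
    by right; rewrite dotZl mulr_gt0 // lt_neqAle eq_sym na.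
  + by right; rewrite dotDl !dotZl; nra.
- move=> y /feasE[[y1 y2 sumy] boxy] ker.
  pose L (T : {set {set 'I_m}}) :=
    ([set: _] |: [set N in T | \sum_(i in N) y 0 i == 0])%SET.
  have topL T : [set: 'I_m]%SET \in L T by rewrite !inE eqxx.
  have lamL T : laminar T -> laminar (L T).
    move=> lamT M N i; rewrite !inE.
    move=> /orP[/eqP -> _ _ _|/andP[MT _]].
      by rewrite finset.subsetT orbT.
    move=> /orP[/eqP -> _ _|/andP[NT _]]; first by rewrite finset.subsetT.
    exact: lamT.
  have L0 T N : N \in L T -> \sum_(i in N) y 0 i = 0.
    rewrite !inE => /orP[/eqP ->|/andP[_ /eqP] //].
    by rewrite -dot_indicator sumT.
  (* The constraints tight at a basic point are zero sums over members of the two families and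
     coordinates equal to 1 or -1; a vector killed by all of them is zero, as integrality
     requires. *)
  have inty : forall i, y 0 i \is a Num.int.
    apply: (two_laminar_integral (lamL _ lam1) (topL _) (lamL _ lam2) (topL _)).
    + by move=> N /L0 ->; apply: rpred0.
    + by move=> N /L0 ->; apply: rpred0.
    move=> u' uint uL1 uL2; apply: ker => k.
    rewrite !mem_cat -!orbA => /or4P[| | |].
    + case/mapP => N; rewrite mem_enum => NT -> /=; rewrite !dot_indicator.
      by move=> yN; apply: uL1; rewrite !inE NT yN eqxx orbT.
    + case/mapP => N; rewrite mem_enum => NT -> /=.
      rewrite !dotNr !dot_indicator => /eqP; rewrite oppr_eq0 => yN.
      by rewrite uL2 ?oppr0 // !inE NT yN orbT.
    + by move=> /eqP -> _ /=; rewrite dot_indicator (uL1 _ (topL T1)).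
    case/or4P=> [/eqP -> _|//|/mapP[i _ ->]|/mapP[i _ ->]] /=.
    + by rewrite dotNr dot_indicator (uL1 _ (topL T1)) oppr0.
    + by rewrite !sum1 => yi; rewrite uint // yi rpredN rpred1.
    + rewrite !dotNr !sum1 => yi.
      by rewrite uint ?oppr0 // -[y 0 i]opprK yi opprK rpred1.
  have [->|y0] := eqVneq y 0; [by left | right].
  rewrite ltNge; apply/negP => yv; apply: noIJ.
  have [I [J [IJD yE]]] := sign_vector_Dset hv inty boxy sumy y0 yv.
  have yN N : \sum_(i in N) y 0 i = #|N :&: J|%:R - #|N :&: I|%:R.
    by rewrite -dot_indicator yE dotBl !dot_indicators.
  exists I, J; split=> // N NT.
  + by rewrite -(ler_nat R) -subr_ge0 -yN y1.
  + by rewrite -(ler_nat R) -subr_le0 -yN y2.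
- apply/feasE; split; first split.
  + move=> N NT; rewrite -dot_indicator dotZl dot_indicator.
    by rewrite mulr_ge0 ?u1 // invr_ge0 ltW.
  + move=> N NT; rewrite -dot_indicator dotZl dot_indicator.
    by rewrite mulr_ge0_le0 ?u2 // invr_ge0 ltW.
  + by rewrite -sumT dotZl sumT sumu mulr0.
  + move=> i; rewrite mxE -ler_norml normrM normfV (gtr0_norm c0).
    rewrite mulrC ler_pdivrMr // mul1r /c (bigD1 i) //= lerDl.
    exact: sumr_ge0.
Qed.

End TwoLaminar.

(** * Paths and nests in a tree *)

Section Parents.
Local Open Scope ring_scope.

Lemma nvertices_gt0 t : (0 < nvertices t)%N. Proof. by case: t. Qed.

Lemma nverticesE t : nvertices t = (nedges t).+1.
Proof. by rewrite /nedges prednK ?nvertices_gt0. Qed.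

(** The inner fixpoint of [parents] is named here, so that the induction on the list of inputs can
    let [next] vary. *)
Let inputs (k : nat) : nat -> seq (option ptree) -> seq nat :=
  fix inputs next s := match s with
     | [::] => [::]
     | None :: s' => inputs next s'
     | Some u :: s' =>
         k :: parents next u ++ inputs (next + nvertices u)%N s'
     end.

Lemma nth_parents k t :
  size (parents k t) = nedges t /\
  forall e, (e < nedges t)%N -> (nth 0%N (parents k t) e <= k + e)%N.
Proof.
have [n] := ubnP (nvertices t); elim: n k t => // n IHn k [s]; rewrite ltnS.
have -> : parents k (Vertex s) = inputs k k.+1 s by [].
rewrite /nedges /= => le_n.
have: (k < k.+1)%N by [].
suff main next : (k < next)%N -> size (inputs k next s) =
    sumn [seq (if x is Some u then nvertices u else 0)%N | x <- s] /\
  forall e, (e < size (inputs k next s))%N ->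
    (nth 0%N (inputs k next s) e < next + e)%N.
  by move=> /main[<- bnd]; split=> // e /bnd.
elim: s next le_n => //= -[u|] s IHs next le_n lt_k; last exact: IHs.
have un : (nvertices u < n.+1)%N by lia.
have [||sz bnd] := IHs (next + nvertices u)%N; [lia..|].
have [|szu bndu] := IHn next u; first by lia.
have nu := nverticesE u.
split=> [|[_|e]] /=; first 1 last.
- by rewrite addn0.
- rewrite size_cat szu nth_cat szu => le_e; case: (ltnP e) => [lt_e|ge_e].
    by rewrite addnS ltnS bndu.
  by have := bnd (e - nedges u)%N; lia.
- by rewrite size_cat szu sz; lia.
Qed.

End Parents.

(** * Paths described by the edges that separate two vertices *)

Section Tree.
Local Open Scope ring_scope.
Variable t : ptree.
Local Notation V := 'I_(nvertices t).
Local Notation E := 'I_(nedges t).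
Implicit Types (e f i : E) (a b x y : V) (M N : {set E}) (NN : {set {set E}}).

Fact upper_subproof e : (e.+1 < nvertices t)%N.
Proof. by rewrite nverticesE ltnS. Qed.
Definition upper e : V := Ordinal (upper_subproof e).

Lemma parent_le e : (nth 0%N (parents 0 t) e <= e)%N.
Proof. by have [_] := nth_parents 0 t; apply. Qed.

Fact lower_subproof e : (nth 0%N (parents 0 t) e < nvertices t)%N.
Proof. by rewrite nverticesE ltnS (leq_trans (parent_le e)) // ltnW. Qed.
Definition lower e : V := Ordinal (lower_subproof e).

Lemma incidentE e x : incident e x = (x == upper e) || (x == lower e).
Proof. by []. Qed.

(** The root is its own parent, so that the path from a vertex to the root is its orbit under
    [parent]. *)
Definition parent x : V :=
  if x == 0%N :> nat then x else
  if insub x.-1 is Some e then lower e else x.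

Lemma parent_upper e : parent (upper e) = lower e.
Proof.
by rewrite /parent /= insubT //= => lt_e; congr lower; apply: val_inj.
Qed.

Lemma vertexP x : (x == 0%N :> nat) \/ exists e, x = upper e.
Proof.
have [x0|x0] := eqVneq (x : nat) 0%N; [by left | right].
have lt_x : (x.-1 < nedges t)%N.
  by have := ltn_ord x; have := nverticesE t; lia.
by exists (Ordinal lt_x); apply: val_inj => /=; lia.
Qed.

Lemma parent_le_self x : (parent x <= x)%N.
Proof.
have [x0|[e ->]] := vertexP x; first by rewrite /parent x0.
by rewrite parent_upper /= leqW ?parent_le.
Qed.

(* [above e x]: the path from [x] to the root goes through [e]. *)
Definition above e x : bool := fconnect parent x (upper e).

Lemma above_gt e x : above e x -> (e < x)%N.
Proof.
move=> /iter_findex; rewrite -[(e < x)%N]/(upper e <= x)%N => <-.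
elim: (findex _ _ _) => //= n; apply: leq_trans; exact: parent_le_self.
Qed.

Lemma above_upper e f : above e (upper f) = (e == f) || above e (lower f).
Proof.
rewrite /above fconnect_eqVf parent_upper; congr (_ || _).
by rewrite -val_eqE /= eqSS eq_sym.
Qed.

Lemma above_lower e : above e (lower e) = false.
Proof.
by apply/negP => /above_gt /=; rewrite ltnNge parent_le.
Qed.

(* The edges of the path from [a] to [b]. *)
Definition sep a b : {set E} := [set e | above e a != above e b].

Lemma sepxx a : sep a a = finset.set0.
Proof. by apply/setP => e; rewrite !inE eqxx. Qed.

Lemma sepC a b : sep a b = sep b a.
Proof. by apply/setP => e; rewrite !inE eq_sym. Qed.

Lemma sep_sub_trans b a c N : sep a b \subset N -> sep b c \subset N ->
  sep a c \subset N.
Proof.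
move=> /fintype.subsetP ab /fintype.subsetP bc; apply/fintype.subsetP => e.
rewrite inE => ac; have [eb|eb] := eqVneq (above e a) (above e b).
  by apply: bc; rewrite inE -eb.
by apply: ab; rewrite inE.
Qed.

Lemma sep_edge e : sep (upper e) (lower e) = [set e].
Proof.
apply/setP => f; rewrite !inE above_upper.
by have [->|_] := eqVneq f e; rewrite ?above_lower ?eqxx.
Qed.

Lemma incident_sep e x y : incident e x -> incident e y ->
  sep x y \subset [set e].
Proof.
rewrite !incidentE => /orP[]/eqP-> /orP[]/eqP->;
  rewrite ?sepxx ?finset.sub0set //.
  by rewrite sep_edge.
by rewrite sepC sep_edge.
Qed.

Lemma connect_joined_sym N : connect_sym (joined N).
Proof.
apply: sym_connect_sym => x y /=.
by apply/eq_existsb => e; rewrite [incident e x && _]andbC.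
Qed.

Lemma connect_joined N x y : connect (joined N) x y = (sep x y \subset N).
Proof.
apply/idP/idP.
  move=> /connectP[p]; elim: p x => [|z p IHp] x /=.
    by move=> _ ->; rewrite sepxx finset.sub0set.
  move=> /andP[/exists_inP[e eN /andP[ex ez]] /IHp pz] /pz.
  apply: sep_sub_trans; apply: fintype.subset_trans (incident_sep ex ez) _.
  by rewrite finset.sub1set.
(* Induction on the sum of the two numbers, replacing the larger vertex by its parent. The vertices
   above an edge [e] have numbers greater than [e], so the edge below [x] separates [x] from the
   smaller [y]. *)
have [n] := ubnP (x + y)%N; elim: n x y => // n IHn x y; rewrite ltnS.
wlog lt_yx : x y / (y < x)%N => [wlt le_n|].
  have [lt_yx|lt_xy|/val_inj->] := ltngtP y x.
  - exact: wlt.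
  2: by rewrite connect0.
  by rewrite sepC connect_joined_sym => xy; apply: wlt => //; rewrite addnC.
have [/eqP x0|[e xe]] := vertexP x; first by rewrite x0 in lt_yx.
rewrite xe in lt_yx *; move=> le_n /fintype.subsetP xyN.
have ye : above e y = false.
  by apply/negP => /above_gt /=; move: lt_yx => /=; lia.
have eN : e \in N by apply: xyN; rewrite inE ye above_upper eqxx.
apply: (connect_trans (y := lower e)).
  apply: connect1; apply/exists_inP; exists e => //.
  by rewrite !incidentE !eqxx orbT.
apply: IHn.
  by apply: leq_trans le_n; rewrite ltn_add2r /= ltnS parent_le.
apply: (@sep_sub_trans (upper e)).
  by rewrite sepC sep_edge finset.sub1set.
exact/fintype.subsetP.
Qed.

Lemma sep_eq0 a b : (sep a b == finset.set0) = (a == b).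
Proof.
apply/idP/eqP => [/eqP ab|->]; last by rewrite sepxx.
have: connect (joined finset.set0) a b by rewrite connect_joined ab.
case/connectP => -[|z p] /=; first by move=> _ ->.
by case/andP => /exists_inP[e]; rewrite inE.
Qed.

Definition verts N : {set V} := [set x | [exists e in N, incident e x]].

Lemma vertsP N x : reflect (exists2 e, e \in N & incident e x) (x \in verts N).
Proof. by rewrite inE; apply: exists_inP. Qed.

Lemma upper_verts N e : e \in N -> upper e \in verts N.
Proof. by move=> eN; apply/vertsP; exists e; rewrite // incidentE eqxx. Qed.

Lemma lower_verts N e : e \in N -> lower e \in verts N.
Proof.
by move=> eN; apply/vertsP; exists e; rewrite // incidentE eqxx orbT.
Qed.

Lemma vertsS M N x : M \subset N -> x \in verts M -> x \in verts N.
Proof.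
by move=> /fintype.subsetP MN /vertsP[e /MN eN ex]; apply/vertsP; exists e.
Qed.

Lemma sep_verts N a b : a != b -> sep a b \subset N -> a \in verts N.
Proof.
rewrite -connect_joined => neab /connectP[[|z p] /=].
  by move=> _ eab; rewrite eab eqxx in neab.
case/andP => /exists_inP[e eN /andP[ea _]] _ _.
by apply/vertsP; exists e.
Qed.

Lemma nestP N : reflect (N != finset.set0 /\
    {in verts N &, forall x y, sep x y \subset N}) (is_nest N).
Proof.
apply: (iffP andP) => -[N0 convN]; split=> //.
  move=> x y; rewrite !inE => xN yN; rewrite -connect_joined.
  by move: convN => /forallP/(_ x)/forallP/(_ y); rewrite xN yN.
apply/forallP => x; apply/forallP => y; apply/implyP => xN; apply/implyP => yN.
by rewrite connect_joined convN // inE.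
Qed.

Lemma nest_sep N x y : is_nest N -> x \in verts N -> y \in verts N ->
  sep x y \subset N.
Proof. by move=> /nestP[_]; apply. Qed.

Lemma vertsU M N x :
  (x \in verts (M :|: N)) = (x \in verts M) || (x \in verts N).
Proof.
apply/vertsP/orP => [[e]|[]/vertsP[e eN ex]]; last 2 first.
- by exists e; rewrite // inE eN.
- by exists e; rewrite // inE eN orbT.
by rewrite inE => /orP[]eN ex; [left|right]; apply/vertsP; exists e.
Qed.

Lemma nestU M N x : is_nest M -> is_nest N -> x \in verts M -> x \in verts N ->
  is_nest (M :|: N).
Proof.
move=> nM nN xM xN; apply/nestP; split.
  case/nestP: nM => /set0Pn[e eM] _; apply/set0Pn; exists e.
  by rewrite inE eM.
have toX y : y \in verts (M :|: N) -> sep y x \subset M :|: N.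
  rewrite vertsU => /orP[yM|yN].
    exact: fintype.subset_trans (nest_sep nM yM xM) (finset.subsetUl _ _).
  exact: fintype.subset_trans (nest_sep nN yN xN) (finset.subsetUr _ _).
move=> y z /toX yx /toX zx; apply: sep_sub_trans yx _.
by rewrite sepC.
Qed.

Lemma nestI M N : is_nest M -> is_nest N -> M :&: N != finset.set0 ->
  is_nest (M :&: N).
Proof.
move=> nM nN MN0; apply/nestP; split=> // x y xMN yMN; rewrite finset.subsetI.
rewrite !nest_sep ?(vertsS (finset.subsetIl _ _) xMN) //.
- exact: vertsS (finset.subsetIr _ _) xMN.
- exact: vertsS (finset.subsetIr _ _) yMN.
- exact: vertsS (finset.subsetIl _ _) yMN.
Qed.

Lemma nest_full : (0 < nedges t)%N -> is_nest [set: E].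
Proof.
move=> m0; apply/nestP; split=> [|x y _ _]; last exact: finset.subsetT.
by apply/set0Pn; exists (Ordinal m0); rewrite inE.
Qed.

Lemma nest1 e : is_nest [set e].
Proof.
apply/nestP; split=> [|x y]; first by apply/set0Pn; exists e; rewrite inE.
move=> /vertsP[f /finset.set1P -> ex] /vertsP[g /finset.set1P -> ey].
exact: incident_sep.
Qed.

(** For distinct edges, [a] is the end of [e] away from [f], and [b] the end of [f] away from [e];
    the path between them crosses both edges. *)
Lemma nest_link N e f : is_nest N -> e \in N -> f \in N ->
  exists a b, [/\ e \in sep a b, f \in sep a b & sep a b \subset N].
Proof.
move=> nN eN fN; have [<-|nef] := eqVneq e f.
  by exists (upper e), (lower e); rewrite sep_edge !inE eqxx finset.sub1set.
have sideb g h : (g == h) = false -> above g (lower h) = above g (upper h).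
  by rewrite above_upper => ->.
have [a [aN ae af]] : exists a, [/\ a \in verts N,
    above e a != above e (upper f) & above f a = above f (upper e)].
  have [eu|eu] := eqVneq (above e (upper e)) (above e (upper f)); last first.
    by exists (upper e); rewrite upper_verts.
  exists (lower e); rewrite lower_verts // (sideb f).
    2: by rewrite eq_sym (negPf nef).
  by rewrite -eu above_lower above_upper eqxx.
have [b [bN be bf]] : exists b, [/\ b \in verts N,
    above e b = above e (upper f) & above f b != above f a].
  have [fu|fu] := eqVneq (above f (upper f)) (above f a); last first.
    by exists (upper f); rewrite upper_verts.
  exists (lower f); rewrite lower_verts // (sideb e).
    2: by rewrite (negPf nef).
  by rewrite -fu above_lower (above_upper f) eqxx.
exists a, b; rewrite !inE be ae [above f a == _]eq_sym bf; split=> //.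
exact: nest_sep.
Qed.

(** * Nestings and their minimal nests *)

Definition comparable_family (C : {set {set E}}) : Prop :=
  forall M N x, M \in C -> N \in C -> x \in verts M -> x \in verts N ->
    (M \subset N) || (N \subset M).

(** Two nests share a vertex exactly when they share an edge or have adjacent edges, so the
    condition on disjoint nests says that only nested ones may share a vertex. *)
Lemma nestingP NN : is_nesting NN <->
  [/\ forall N, N \in NN -> is_nest N,
      (0 < nedges t)%N -> [set: E] \in NN & comparable_family NN].
Proof.
split=> [/and3P[/forall_inP nest /implyP top /forall_inP comp]|[nest top comp]].
  split=> // M N x MN NN'; have [->|neMN] := eqVneq M N.
    by rewrite fintype.subxx.
  move: (comp M MN) => /forall_inP/(_ N NN'); rewrite neMN => /or3P[||].
  - by move=> /proper_sub->.
  - by move=> /proper_sub->; rewrite orbT.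
  case/andP=> _ /forall_inP nadj /vertsP[e eM ex] /vertsP[f fN fx].
  move: (nadj e eM) => /forall_inP/(_ f fN)/existsP[]; exists x.
  by rewrite ex fx.
apply/and3P; split; [exact/forall_inP | exact/implyP | ].
apply/forall_inP => M MN; apply/forall_inP => N NN'; apply/implyP => neMN.
have [[x xM xN]|noshare] := pselect (exists2 x, x \in verts M & x \in verts N).
  have := comp M N x MN NN' xM xN.
  by rewrite !finset.properEneq neMN [N == M]eq_sym neMN /= => /orP[]->;
    rewrite ?orbT.
apply/or3P/Or33/andP; split.
  apply/pred0P => e /=; apply/negP => /andP[eM eN]; apply: noshare.
  by exists (upper e); apply: upper_verts.
apply/forall_inP => e eM; apply/forall_inP => f fN; apply/existsP => -[x].
move=> /andP[ex fx]; apply: noshare.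
by exists x; apply/vertsP; [exists e | exists f].
Qed.

Lemma comparable_laminar NN : comparable_family NN -> laminar NN.
Proof.
move=> comp M N i MN NN' iM iN.
by apply: (comp M N (upper i)) => //; apply: upper_verts.
Qed.

(** Along the path from [x] to [y], the member reached so far and a member covering the next edge
    share a vertex; the larger of the two contains [x] and the next vertex. *)
Lemma comparable_cover (C : {set {set E}}) (X : {set E}) x y :
    comparable_family C ->
    (forall e, e \in X -> exists2 M, M \in C & e \in M) ->
    x \in verts X -> sep x y \subset X ->
  exists M, [/\ M \in C, x \in verts M & y \in verts M].
Proof.
move=> comp cov xX; rewrite -connect_joined => /connectP[p].
elim/last_ind: p y => [|p z IHp] y /=.
  move=> _ ->; case/vertsP: xX => e /cov[M MC eM] ex; exists M.
  by split=> //; apply/vertsP; exists e.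
rewrite rcons_path last_rcons => /andP[/IHp/(_ erefl)[M [MC xM yM]]].
move=> /exists_inP[e /cov[N NC eN] /andP[ey ez]] ->.
have yN : last x p \in verts N by apply/vertsP; exists e.
have zN : z \in verts N by apply/vertsP; exists e.
have /orP[MN|NM] := comp M N _ MC NC yM yN.
  by exists N; split=> //; apply: vertsS xM.
by exists M; split=> //; apply: vertsS zN.
Qed.

Section Nesting.
Variable NN : {set {set E}}.
Hypothesis nNN : is_nesting NN.

Lemma nesting_nest N : N \in NN -> is_nest N.
Proof. by case/nestingP: nNN => nest _ _; apply: nest. Qed.

Lemma nesting_full e : [set: E] \in NN.
Proof.
case/nestingP: nNN => _ top _; apply: top.
exact: leq_ltn_trans (ltn_ord e).
Qed.

Lemma nesting_comparable : comparable_family NN.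
Proof. by case/nestingP: nNN. Qed.

Lemma nesting_laminar : laminar NN.
Proof. exact: comparable_laminar nesting_comparable. Qed.

Lemma min_nest_in e : min_nest NN e \in NN.
Proof. exact: least_in nesting_laminar (nesting_full e) e. Qed.

Lemma mem_min_nest e : e \in min_nest NN e.
Proof. exact: mem_least nesting_laminar (nesting_full e) e. Qed.

Lemma min_nest_sub e N : N \in NN -> e \in N -> min_nest NN e \subset N.
Proof. exact: least_sub nesting_laminar (nesting_full e) e N. Qed.

Lemma min_nest_nest e : is_nest (min_nest NN e).
Proof. exact: nesting_nest (min_nest_in e). Qed.

(* The edges of the path from [a] to [b] that are cut while [a] and [b] still
   lie in the same piece. *)
Definition splitters a b : {set E} :=
  [set i in sep a b | sep a b \subset min_nest NN i].

Lemma in_splitters a b i :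
  (i \in splitters a b) = (i \in sep a b) && (sep a b \subset min_nest NN i).
Proof. by rewrite finset.in_set. Qed.

(** The minimal nests of the edges of the path cover it and are comparable, so one of them contains
    both ends, hence the whole path. *)
Lemma splitters_neq0 a b : a != b -> splitters a b != finset.set0.
Proof.
move=> neab; pose C := [set min_nest NN i | i in sep a b]%SET.
have compC : comparable_family C.
  move=> M N x /imsetP[i _ ->] /imsetP[j _ ->].
  by apply: nesting_comparable; apply: min_nest_in.
have cov e : e \in sep a b -> exists2 M, M \in C & e \in M.
  move=> eab; exists (min_nest NN e); last exact: mem_min_nest.
  exact: imset_f.
have aX : a \in verts (sep a b) by apply: sep_verts neab _.
have [M [/imsetP[i iab ->] aM bM]] :=
  comparable_cover compC cov aX (fintype.subxx _).
apply/set0Pn; exists i; rewrite in_splitters iab.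
exact: nest_sep (min_nest_nest i) aM bM.
Qed.

(** The edge [i] has the largest minimal nest among the edges of [N]. Any vertex of [N] lies with
    [upper i] in some minimal nest, which by comparability and maximality is contained in that of
    [i]. *)
Lemma nest_top N : is_nest N -> exists2 i, i \in N & N \subset min_nest NN i.
Proof.
move=> nN; have /nestP[/set0Pn[i0 i0N] _] := nN.
have [i iN maxi] := arg_maxnP (fun i => #|min_nest NN i|) i0N.
exists i => //; pose C := [set min_nest NN j | j in N]%SET.
have compC : comparable_family C.
  move=> M M' x /imsetP[j _ ->] /imsetP[k _ ->].
  by apply: nesting_comparable; apply: min_nest_in.
have cov e : e \in N -> exists2 M, M \in C & e \in M.
  move=> eN; exists (min_nest NN e); last exact: mem_min_nest.
  exact: imset_f.
have inv x : x \in verts N -> x \in verts (min_nest NN i).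
  move=> xN; have iV := upper_verts iN.
  have [M [/imsetP[j jN ->] uM xM]] :=
    comparable_cover compC cov iV (nest_sep nN iV xN).
  have /orP[] := nesting_comparable (min_nest_in j) (min_nest_in i) uM
    (upper_verts (mem_min_nest i)); first by move/vertsS; apply.
  have le_ji : (#|min_nest NN j| <= #|min_nest NN i|)%N := maxi j jN.
  move=> ij; have := geq_leqif (subset_leqif_card ij).
  by rewrite le_ji => /esym /vertsS; apply.
apply/fintype.subsetP => e eN.
have := nest_sep (min_nest_nest i)
  (inv _ (upper_verts eN)) (inv _ (lower_verts eN)).
by rewrite sep_edge finset.sub1set.
Qed.

Lemma min_nest_onto : [set min_nest NN i | i in [set: E]] = NN.
Proof.
apply/setP => N; apply/imsetP/idP => [[i _ ->]|NNN]; first exact: min_nest_in.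
have [i iN Ni] := nest_top (nesting_nest NNN).
by exists i => //; apply/eqP; rewrite finset.eqEsubset Ni min_nest_sub.
Qed.

Lemma card_nesting : (#|NN| <= nedges t)%N.
Proof.
by rewrite -min_nest_onto (leq_trans (leq_imset_card _ _)) // cardsT card_ord.
Qed.

End Nesting.

(** In a maximal nesting, [min_nest] is a bijection from edges to nests, while two splitters of the
    same pair have equal minimal nests. *)
Lemma splitter_unique NN a b i j : max_nesting NN ->
  i \in splitters NN a b -> j \in splitters NN a b -> i = j.
Proof.
case/andP=> nNN /eqP cardNN; rewrite !in_splitters.
move=> /andP[iab sub_i] /andP[jab sub_j].
have inj : {in [set: E] &, injective (min_nest NN)}.
  by apply/imset_injP; rewrite min_nest_onto // cardNN cardsT card_ord.
apply: inj; rewrite ?inE //; apply/eqP; rewrite finset.eqEsubset.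
rewrite !min_nest_sub ?min_nest_in //.
  exact: (fintype.subsetP sub_i).
exact: (fintype.subsetP sub_j).
Qed.

(** This turns the product of the weights of the two pieces into a sum over the pairs of vertices
    separated by [i] inside [N]. *)
Lemma cut_sep N i a b : is_nest N -> i \in N ->
  (a \in cut_above N i) && (b \in cut_below N i) =
  (i \in sep a b) && (sep a b \subset N) && above i a.
Proof.
move=> nN iN.
have cutA y : (y \in cut_above N i) = (sep (upper i) y \subset N :\ i).
  rewrite inE -connect_joined; apply/existsP/idP => [[x /andP[/eqP xi]]|].
    by have -> : x = upper i by apply: val_inj.
  by exists (upper i); rewrite /upper_end eqxx.
have cutB y : (y \in cut_below N i) = (sep (lower i) y \subset N :\ i).
  rewrite inE -connect_joined; apply/existsP/idP => [[x /andP[/eqP xi]]|].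
    by have -> : x = lower i by apply: val_inj.
  by exists (lower i); rewrite /lower_end eqxx.
have upi : above i (upper i) by rewrite above_upper eqxx.
have iE x y : (i \in sep x y) = (above i x != above i y) by rewrite inE.
have subD x y : (sep x y \subset N :\ i) =
    (sep x y \subset N) && (i \notin sep x y).
  by rewrite subsetD1.
rewrite cutA cutB !subD !iE upi above_lower !negbK.
apply/idP/idP.
  move=> /andP[/andP[uN /eqP <-] /andP[lN /eqP <-]] /=; rewrite andbT.
  apply: (@sep_sub_trans (upper i)); first by rewrite sepC.
  by apply: sep_sub_trans lN; rewrite sep_edge finset.sub1set.
case/andP=> /andP[ab abN] ai; rewrite ai in ab *.
have neab : a != b by apply: contraNneq ab => <-; rewrite ai.
have aN := sep_verts neab abN.
have bN : b \in verts N by apply: (@sep_verts _ b a); rewrite 1?eq_sym // sepC.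
by rewrite !nest_sep ?upper_verts ?lower_verts //=.
Qed.

End Tree.

(** * Inequalities of the operahedron *)

Section Convex.
Local Open Scope ring_scope.
Variables (R : realType) (m : nat) (T : finType) (S : {pred T}).
Variable p : T -> 'rV[R]_m.

Lemma conv_convex : convex_prop (conv S p).
Proof.
move=> _ _ a a0 a1 [f [f0 f1 ->]] [g [g0 g1 ->]].
exists (fun i => a * f i + (1 - a) * g i); split.
- by move=> i iS; rewrite addr_ge0 // mulr_ge0 ?f0 ?g0 // subr_ge0.
- by rewrite big_split -!mulr_sumr /= f1 g1; ring.
- rewrite !scaler_sumr -big_split; apply: eq_bigr => i _.
  by rewrite /= [RHS]scalerDl !scalerA.
Qed.

Lemma conv_vertex i : i \in S -> conv S p (p i).
Proof.
move=> iS; exists (fun j => (j == i)%:R); split=> [j _||].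
- exact: ler0n.
- by rewrite (bigD1 i) //= eqxx big1 ?addr0 // => j /andP[_ /negPf->].
- rewrite (bigD1 i) //= eqxx scale1r big1 ?addr0 // => j /andP[_ /negPf->].
  by rewrite scale0r.
Qed.

Lemma conv_dot c b x : conv S p x -> (forall i, i \in S -> b <= dot (p i) c) ->
  b <= dot x c.
Proof.
move=> [f [f0 f1 ->]] bp.
have -> : dot (\sum_(i in S) f i *: p i) c = \sum_(i in S) f i * dot (p i) c.
  elim/big_rec2: _ => [|i y z _ <-]; first by rewrite dot0l.
  by rewrite dotDl dotZl.
rewrite -[b]mul1r -f1 mulr_suml; apply: ler_sum => i iS.
by rewrite ler_wpM2l ?f0 ?bp.
Qed.

End Convex.

(** * The bounds [theta] and the generic points of the faces *)

Section Operahedron.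
Local Open Scope ring_scope.
Variables (R : realType) (t : ptree) (w : 'I_(nvertices t) -> nat).
Hypothesis hw : forall x, (0 < w x)%N.
Local Notation V := 'I_(nvertices t).
Local Notation E := 'I_(nedges t).
Implicit Types (i : E) (p : V * V) (M N S : {set E}) (NN : {set {set E}}).
Implicit Types (u x y z v d : 'rV[R]_(nedges t)).

Lemma ltr_sum_exists (I : finType) (F G : I -> R) :
  (forall k, F k <= G k) -> (exists k, F k < G k) -> \sum_k F k < \sum_k G k.
Proof.
move=> leFG [k ltFG]; rewrite (bigD1 k) //= [ltRHS](bigD1 k) //=.
by rewrite ltr_leD // ler_sum.
Qed.

(* Pairs of vertices are ordered, hence the factor 1/2. *)
Definition pair_weight p : R := (w p.1 * w p.2)%:R / 2.

Lemma pair_weight_gt0 p : 0 < pair_weight p.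
Proof. by rewrite divr_gt0 ?ltr0n ?muln_gt0 ?hw. Qed.

Definition joins S p : bool := (p.1 != p.2) && (sep p.1 p.2 \subset S).

Definition theta S : R := \sum_p pair_weight p * (joins S p)%:R.

Lemma theta0 : theta finset.set0 = 0.
Proof.
apply: big1 => p _; rewrite /joins finset.subset0 sep_eq0 andNb mulr0 //.
Qed.

Lemma theta_gt0 N : is_nest N -> 0 < theta N.
Proof.
case/nestP=> /set0Pn[e eN] _; rewrite /theta (bigD1 (upper e, lower e)) //=.
rewrite ltr_pwDl //.
  have ul : upper e != lower e.
    by rewrite -sep_eq0 sep_edge; apply/set0Pn; exists e; rewrite inE.
  by rewrite /joins /= ul sep_edge finset.sub1set eN mulr1 pair_weight_gt0.
by apply: sumr_ge0 => p _; rewrite mulr_ge0 // ltW // pair_weight_gt0.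
Qed.

(** No pair of vertices counts more on the left than on the right. A path through an edge of [M]
    outside [N] and an edge of [N] outside [M] gives a pair that counts for the union only, hence
    strictness. *)
Lemma theta_supermodular M N (x : V) : is_nest M -> is_nest N ->
    x \in verts M -> x \in verts N -> ~~ ((M \subset N) || (N \subset M)) ->
  theta M + theta N < theta (M :|: N) + theta (M :&: N).
Proof.
move=> nM nN xM xN; rewrite negb_or.
move=> /andP[/subsetPn[e eM eN] /subsetPn[f fN fM]].
have nU := nestU nM nN xM xN.
have [||a [b [eab fab abU]]] := @nest_link _ _ e f nU.
- by rewrite inE eM.
- by rewrite inE fN orbT.
rewrite /theta -!big_split /=.
apply: ltr_sum_exists => [p|].
  rewrite -!mulrDr ler_wpM2l ?(ltW (pair_weight_gt0 _)) //.
  rewrite /joins finset.subsetI; case: (p.1 != p.2) => //=.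
  have hM h : sep p.1 p.2 \subset _ :=
    fintype.subset_trans h (finset.subsetUl M N).
  have hN h : sep p.1 p.2 \subset _ :=
    fintype.subset_trans h (finset.subsetUr M N).
  case: (boolP (_ \subset M)) => [/hM->|_] /=; first by rewrite addrC.
  case: (boolP (_ \subset N)) => [/hN->|_] /=; first by rewrite addrC.
  by rewrite !addr0 ler0n.
exists (a, b); rewrite -!mulrDr ltr_pM2l ?pair_weight_gt0 //.
have neab : a != b.
  by rewrite -sep_eq0; apply/set0Pn; exists e.
rewrite /joins /= neab abU finset.subsetI /=.
have /negPf-> : ~~ (sep a b \subset M).
  by apply: contraNN fM => /fintype.subsetP; apply.
have /negPf-> : ~~ (sep a b \subset N).
  by apply: contraNN eN => /fintype.subsetP; apply.
by rewrite !addr0 ltr01.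
Qed.

(* The weight of each pair of vertices is shared evenly between the edges that
   may be the first to separate it in a maximal refinement of [NN]: a point in
   the relative interior of the face of [NN]. *)
Definition generic_point NN : 'rV[R]_(nedges t) :=
  \row_i \sum_(p | i \in splitters NN p.1 p.2)
     pair_weight p / #|splitters NN p.1 p.2|%:R.

(** For a pair of equal vertices the quotient is 0 / 0, that is 0, in agreement with [joins]. *)
Definition share NN S p : R :=
  #|S :&: splitters NN p.1 p.2|%:R / #|splitters NN p.1 p.2|%:R.

Lemma generic_point_sum NN S :
  \sum_(i in S) generic_point NN 0 i = \sum_p pair_weight p * share NN S p.
Proof.
under eq_bigr do rewrite mxE.
rewrite (exchange_big_dep predT) //=; apply: eq_bigr => p _.
rewrite (eq_bigl (mem (S :&: splitters NN p.1 p.2))); last first.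
  by move=> i; rewrite !inE.
rewrite sumr_const /share -[LHS]mulr_natr; ring.
Qed.

Section Nesting.
Variable NN : {set {set E}}.
Hypothesis nNN : is_nesting NN.

Lemma joins_share S p : (joins S p)%:R <= share NN S p.
Proof.
rewrite /joins; have [eqp|nep] /= := eqVneq p.1 p.2.
  by rewrite /share divr_ge0.
case: (boolP (_ \subset S)) => [subS|_]; last by rewrite /share divr_ge0.
rewrite /share (finset.setIidPr _) ?divff //.
  by rewrite pnatr_eq0 cards_eq0 splitters_neq0.
apply: fintype.subset_trans subS; apply/fintype.subsetP => i.
by rewrite in_splitters => /andP[].
Qed.

Lemma generic_point_ge S : theta S <= \sum_(i in S) generic_point NN 0 i.
Proof.
rewrite generic_point_sum; apply: ler_sum => p _.
by rewrite ler_wpM2l ?joins_share // ltW ?pair_weight_gt0.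
Qed.

(** If [N] contains a splitter of a pair, it contains the minimal nest of that splitter, hence the
    whole path; so only pairs joined in [N] contribute. *)
Lemma generic_point_eq N : N \in NN ->
  \sum_(i in N) generic_point NN 0 i = theta N.
Proof.
move=> NNN; apply/le_anti; rewrite generic_point_ge andbT generic_point_sum.
apply: ler_sum => p _; rewrite ler_wpM2l ?(ltW (pair_weight_gt0 _)) //.
have [T0|/set0Pn[i iNT]] := eqVneq (N :&: splitters NN p.1 p.2) finset.set0.
  by rewrite /share T0 cards0 mul0r ler0n.
have /andP[iN] : (i \in N) && (i \in splitters NN p.1 p.2).
  by rewrite -finset.in_setI.
rewrite in_splitters => /andP[ip pN].
have -> : joins N p.
  rewrite /joins (fintype.subset_trans pN) ?min_nest_sub // andbT.
  by rewrite -sep_eq0; apply/set0Pn; exists i.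
rewrite /share ler_pdivrMr ?mul1r ?ler_nat ?subset_leq_card ?finset.subsetIr //.
rewrite ltr0n card_gt0 splitters_neq0 // -sep_eq0.
by apply/set0Pn; exists i.
Qed.

(** Since [N] is not in [NN], the minimal nest of its top edge [i] has an edge [f] outside [N]. A
    path through [i] and [f] in that nest has [i] as a splitter in [N] but is not contained in
    [N]. *)
Lemma generic_point_gt N : is_nest N -> N \notin NN ->
  theta N < \sum_(i in N) generic_point NN 0 i.
Proof.
move=> nN NNN; have [i iN Ni] := nest_top nNN nN.
have [|f fi fN] := @subsetPn _ (min_nest NN i) N _.
  apply: contraNN NNN => iN'; suff -> : N = min_nest NN i by apply: min_nest_in.
  by apply/eqP; rewrite finset.eqEsubset Ni.
have [a [b [iab fab abi]]] :=
  nest_link (min_nest_nest nNN i) (mem_min_nest nNN i) fi.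
rewrite generic_point_sum; apply: ltr_sum_exists => [p|].
  by rewrite ler_wpM2l ?joins_share // ltW ?pair_weight_gt0.
exists (a, b); rewrite ltr_pM2l ?pair_weight_gt0 //.
have /negPf-> : ~~ joins N (a, b).
  by rewrite /joins /= negb_and orbC; apply/orP; left; apply/subsetPn; exists f.
have iT : i \in splitters NN a b by rewrite in_splitters iab.
rewrite /share divr_gt0 // ltr0n card_gt0; apply/set0Pn; exists i => //.
by rewrite inE iN.
Qed.

End Nesting.

(** Each pair has one splitter, so coordinate [i] collects the pairs split by [i]. Those with first
    vertex above [i] and those with first vertex below contribute half of [alpha * beta] each. *)
Lemma loday_generic NN : max_nesting NN ->
  loday_point R w NN = generic_point NN.
Proof.
move=> mNN; have /andP[nNN _] := mNN; apply/rowP => i; rewrite !mxE.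
have card1 p : i \in splitters NN p.1 p.2 -> #|splitters NN p.1 p.2| = 1%N.
  move=> ip; apply/eqP/cards1P; exists i; apply/setP => j; rewrite inE.
  by apply/idP/eqP => [/(splitter_unique mNN ip)|->].
under eq_bigr => p ip do rewrite (card1 p ip) divr1.
rewrite /alpha /beta; set N := min_nest NN i.
have nN : is_nest N := min_nest_nest nNN i.
have iN : i \in N := mem_min_nest nNN i.
pose W := \sum_(p | (i \in splitters NN p.1 p.2) && above i p.1) pair_weight p.
have half : \sum_(p | (i \in splitters NN p.1 p.2) && ~~ above i p.1)
    pair_weight p = W.
  rewrite (reindex (fun p : V * V => (p.2, p.1))) /=; last first.
    by exists (fun p => (p.2, p.1)) => -[].
  rewrite /W /pair_weight; apply: eq_big => p /=; last by rewrite mulnC.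
  rewrite !in_splitters (sepC p.2) [i \in sep _ _]inE.
  by case: (above i p.1); case: (above i p.2); rewrite ?andbF.
rewrite (bigID (fun p => above i p.1)) /= half -/W.
have -> : W = ((\sum_(a in cut_above N i) w a) *
    \sum_(b in cut_below N i) w b)%:R / 2.
  rewrite big_distrlr /= pair_big /= natr_sum mulr_suml; apply: eq_bigl => p.
  by rewrite cut_sep // in_splitters.
by field.
Qed.

(** * The polytope and its faces by inequalities *)

Lemma sum_setT x : \sum_(i in [set: E]) x 0 i = \sum_i x 0 i.
Proof. by apply: eq_bigl => i; rewrite inE. Qed.

Lemma sum_setUI x M N : \sum_(i in M :|: N) x 0 i + \sum_(i in M :&: N) x 0 i =
  \sum_(i in M) x 0 i + \sum_(i in N) x 0 i.
Proof.
rewrite !(big_mkcond (fun i => i \in _)) -!big_split; apply: eq_bigr => i _ /=.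
by rewrite !inE; case: (i \in M); case: (i \in N); rewrite /= ?addr0 ?add0r.
Qed.

Definition in_polytope x : Prop := \sum_i x 0 i = theta [set: E] /\
  forall N, is_nest N -> theta N <= \sum_(i in N) x 0 i.

Definition tight x : {set {set E}} :=
  [set N | is_nest N && (\sum_(i in N) x 0 i == theta N)].

Lemma tightP x N :
  reflect (is_nest N /\ \sum_(i in N) x 0 i = theta N) (N \in tight x).
Proof. by rewrite inE; apply: (iffP andP) => -[? /eqP]. Qed.

(** Uncrossing: if two tight nests shared a vertex without being nested, strict supermodularity
    would violate the bound of their union or of their intersection. *)
Lemma tight_nesting x : in_polytope x -> is_nesting (tight x).
Proof.
move=> [sumx xN]; apply/nestingP; split=> [N /tightP[]//|m0|M N y].
  by apply/tightP; rewrite sum_setT; split=> //; apply: nest_full.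
move=> /tightP[nM xM] /tightP[nN xNN] yM yN; apply/negPn/negP => ncomp.
have := theta_supermodular nM nN yM yN ncomp.
rewrite -xM -xNN -sum_setUI ltNge lerD ?(xN _ (nestU nM nN yM yN)) //.
have [->|MN0] := eqVneq (M :&: N) finset.set0; first by rewrite theta0 big_set0.
exact/xN/nestI.
Qed.

Lemma generic_point_in NN : is_nesting NN -> in_polytope (generic_point NN).
Proof.
move=> nNN; split=> [|N _]; last exact: generic_point_ge.
rewrite -sum_setT; have [m0|m0] := posnP (nedges t); last first.
  by apply: generic_point_eq => //; case/nestingP: nNN => _ top _; apply: top.
have -> : [set: E] = finset.set0.
  apply/eqP/set0Pn => -[i _]; have := leq_ltn_trans (leq0n i) (ltn_ord i).
  by rewrite m0.
by rewrite big_set0 theta0.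
Qed.

Lemma tight_generic_point NN : is_nesting NN ->
  tight (generic_point NN) \subset NN.
Proof.
move=> nNN; apply/fintype.subsetP => N /tightP[nN eqN].
by apply/negPn/negP => /(generic_point_gt nNN nN); rewrite eqN ltxx.
Qed.

Section Face.
Variable NN : {set {set E}}.
Hypothesis nestNN : forall N, N \in NN -> is_nest N.

(** The full edge set is added explicitly because it is not a nest when the tree has a single
    vertex. The opposite inequalities turn bounds into equations. *)
Definition face_constraints : seq ('rV[R]_(nedges t) * R) :=
  [seq (indicator R N, theta N) | N <- enum ([set: E] |: [set N | is_nest N])]
  ++ [seq (- indicator R N, - theta N) | N <- enum ([set: E] |: NN)].

Lemma face_constraintsP (Q : 'rV[R]_(nedges t) * R -> Prop) :
  (forall k, k \in face_constraints -> Q k) <->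
  [/\ Q (indicator R [set: E], theta [set: E]),
      Q (- indicator R [set: E], - theta [set: E]),
      forall N, is_nest N -> Q (indicator R N, theta N) &
      forall N, N \in NN -> Q (- indicator R N, - theta N)].
Proof.
split=> [Qs|[Q1 Q2 Q3 Q4] k].
  split=> [||N hN|N hN]; apply: Qs; rewrite mem_cat; apply/orP.
  - by left; apply/mapP; exists [set: E]; rewrite // mem_enum !inE eqxx.
  - by right; apply/mapP; exists [set: E]; rewrite // mem_enum !inE eqxx.
  - by left; apply/mapP; exists N; rewrite // mem_enum !inE hN orbT.
  - by right; apply/mapP; exists N; rewrite // mem_enum !inE hN orbT.
rewrite mem_cat => /orP[]/mapP[N]; rewrite mem_enum !inE.
  by move=> /orP[/eqP->|nN] ->; [exact: Q1 | exact: Q3].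
by move=> /orP[/eqP->|nN] ->; [exact: Q2 | exact: Q4].
Qed.

Lemma feasible_face x : feasible face_constraints x <->
  in_polytope x /\ NN \subset tight x.
Proof.
rewrite /feasible face_constraintsP /= !dotNr !dot_indicator sum_setT !lerN2.
split=> [[le1 le2 xN xNN]|[[-> xN] /fintype.subsetP tNN]].
  have xnest N : is_nest N -> theta N <= \sum_(i in N) x 0 i.
    by move=> /xN; rewrite dot_indicator.
  split; first by split=> //; apply/le_anti; rewrite le1 le2.
  apply/fintype.subsetP => N NNN; apply/tightP; split; first exact: nestNN.
  apply/le_anti; rewrite xnest ?nestNN // andbT.
  by have := xNN N NNN; rewrite dotNr dot_indicator lerN2.
split=> // N NNN; first by rewrite dot_indicator xN.
by rewrite dotNr dot_indicator; case/tightP: (tNN N NNN) => _ ->.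
Qed.

Lemma loday_face NN' : max_nesting NN' -> NN \subset NN' ->
  feasible face_constraints (loday_point R w NN').
Proof.
move=> mNN' /fintype.subsetP sNN; have /andP[nNN' _] := mNN'.
rewrite loday_generic //; apply/feasible_face; split.
  exact: generic_point_in.
apply/fintype.subsetP => N NNN; apply/tightP; split; first exact: nestNN.
by apply: generic_point_eq => //; apply: sNN.
Qed.

(** With fewer tight nests than edges, some nonzero direction would keep all of them tight; so the
    tight nesting is maximal. Its equations then have a single solution, which its Loday point also
    satisfies. *)
Lemma basic_point_loday y : feasible face_constraints y ->
    (forall u, (forall k, k \in face_constraints ->
       dot y k.1 = k.2 -> dot u k.1 = 0) -> u = 0) ->
  max_nesting (tight y) /\ y = loday_point R w (tight y).
Proof.
move=> /feasible_face[yP /fintype.subsetP sNN] ker.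
have nT := tight_nesting yP.
have kerT u : (forall N, N \in tight y -> \sum_(i in N) u 0 i = 0) ->
    \sum_i u 0 i = 0 -> u = 0.
  move=> uT sumu; apply: ker; apply/face_constraintsP; split=> /=.
  - by rewrite !dot_indicator !sum_setT sumu.
  - by rewrite !dotNr !dot_indicator !sum_setT sumu oppr0.
  - by move=> N nN; rewrite !dot_indicator => yN; apply: uT; apply/tightP.
  - by move=> N /sNN NT _; rewrite dotNr dot_indicator uT ?oppr0.
have mT : max_nesting (tight y).
  rewrite /max_nesting nT eqn_leq card_nesting //= leqNgt; apply/negP => lt_m.
  have [|u /eqP u0 us] :=
    @dot_kernel R _ [seq indicator R N | N <- enum (tight y)].
    by rewrite size_map -cardE.
  have uT N : N \in tight y -> \sum_(i in N) u 0 i = 0.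
    move=> NT; rewrite -dot_indicator us //; apply/mapP.
    by exists N; rewrite ?mem_enum.
  apply: u0; apply: kerT => //; rewrite -sum_setT; apply: uT.
  by case/nestingP: nT => _ top _; apply: top; apply: leq_ltn_trans lt_m.
split=> //; apply/eqP; rewrite -subr_eq0; apply/eqP; rewrite loday_generic //.
apply: kerT => [N NT|].
  rewrite -dot_indicator dotBl !dot_indicator generic_point_eq //.
  by case/tightP: NT => _ ->; rewrite subrr.
rewrite -sum_setT -dot_indicator dotBl !dot_indicator !sum_setT.
by rewrite (proj1 yP) (proj1 (generic_point_in nT)) subrr.
Qed.

Lemma nesting_faceE x :
  nesting_face R w NN x <-> in_polytope x /\ NN \subset tight x.
Proof.
rewrite -feasible_face; split=> [xF k ks|].
  apply: conv_dot xF _ => NN' /andP[mNN' sNN].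
  exact: loday_face mNN' sNN k ks.
apply: (@polyhedron_ind _ _ _ (nesting_face R w NN)).
(* Single edges are nests, so a recession direction has nonnegative coordinates, while its total is
   at most 0. *)
- move=> u /face_constraintsP[_ /= u2 u3 _].
  have u0 i : 0 <= u 0 i.
    by have := u3 _ (nest1 i); rewrite dot_indicator big_set1.
  move: u2; rewrite dotNr dot_indicator sum_setT oppr_ge0 => u2.
  have sumu : \sum_i u 0 i = 0 by apply/le_anti; rewrite u2 sumr_ge0.
  by apply/rowP => i; rewrite mxE (psumr_eq0P _ sumu).
- exact: conv_convex.
- move=> y fy ker; have [mT ->] := basic_point_loday fy ker.
  apply: conv_vertex; rewrite inE mT /=.
  by case/feasible_face: fy.
Qed.

End Face.

Lemma operahedronE x : operahedron R w x <-> in_polytope x.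
Proof.
have -> : operahedron R w = nesting_face R w finset.set0.
  rewrite /operahedron /nesting_face; congr conv; apply/funext => NN /=.
  by rewrite finset.sub0set andbT.
rewrite nesting_faceE ?finset.sub0set; last by move=> N; rewrite inE.
by split=> [[]|].
Qed.

Lemma in_polytope_convex : convex_prop in_polytope.
Proof.
move=> x y a a0 a1 [sx xN] [sy yN]; split=> [|N nN].
  rewrite -sum_setT -dot_indicator dotDl !dotZl !dot_indicator !sum_setT sx sy.
  ring.
rewrite -dot_indicator dotDl !dotZl !dot_indicator.
have := xN N nN; have := yN N nN; nra.
Qed.

(** * Feasible displacements *)

Lemma in_polytope_move x d : in_polytope x -> \sum_i d 0 i = 0 ->
    (forall N, N \in tight x -> 0 <= \sum_(i in N) d 0 i) ->
  exists2 a : R, 0 < a & forall b : R, 0 <= b <= a -> in_polytope (x + b *: d).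
Proof.
move=> xP sumd dN.
have no0 N : N \in (finset.set0 : {set {set E}}) -> is_nest N by rewrite inE.
have fx : feasible (face_constraints finset.set0) x.
  by apply/feasible_face => //; split; rewrite ?finset.sub0set.
have [|a a0 fa] := @feasible_move _ _ _ x d fx.
  apply/face_constraintsP; split=> /=.
  - by rewrite !dot_indicator !sum_setT sumd.
  - by rewrite !dotNr !dot_indicator !sum_setT sumd oppr0.
  - by move=> N nN; rewrite !dot_indicator => xN; apply/dN/tightP.
  - by move=> N; rewrite inE.
have [aP _] : in_polytope (x + a *: d) /\
    finset.set0 \subset tight (x + a *: d).
  exact/feasible_face.
exists a => // b /andP[b0 ba].
have -> : x + b *: d = (b / a) *: (x + a *: d) + (1 - b / a) *: x.
  by apply/rowP => i; rewrite !mxE; field; lra.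
apply: in_polytope_convex => //; first by rewrite divr_ge0 // ltW.
by rewrite ler_pdivrMr // mul1r.
Qed.

Lemma in_polytope_move2 x y d : in_polytope x -> in_polytope y ->
    \sum_i d 0 i = 0 ->
    (forall N, N \in tight x -> 0 <= \sum_(i in N) d 0 i) ->
    (forall N, N \in tight y -> \sum_(i in N) d 0 i <= 0) ->
  exists2 a : R, 0 < a & in_polytope (x + a *: d) /\ in_polytope (y - a *: d).
Proof.
move=> xP yP sumd dx dy; have [a a0 xa] := in_polytope_move xP sumd dx.
have sumN M : \sum_(i in M) (- d) 0 i = - \sum_(i in M) d 0 i.
  by rewrite -[LHS]dot_indicator dotNl dot_indicator.
have [||b b0 yb] := @in_polytope_move y (- d) yP.
- by rewrite -sum_setT sumN sum_setT sumd oppr0.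
- by move=> N /dy; rewrite sumN oppr_ge0.
exists (Num.min a b); first by rewrite lt_min a0.
split; first by apply: xa; rewrite ge_min lexx le_min (ltW a0) (ltW b0).
rewrite -scalerN; apply: yb.
by rewrite ge_min lexx orbT le_min (ltW a0) (ltW b0).
Qed.

(** * The diagonal *)

Section Diagonal.
Variable v : 'rV[R]_(nedges t).
Hypothesis hv : principal_orientation v.

Lemma cone_Dset x y d : in_polytope x -> d != 0 ->
    in_polytope (x + d) -> in_polytope (y - d) -> dot d v <= 0 ->
    forall NN NN', is_nesting NN -> is_nesting NN' ->
    NN \subset tight x -> NN' \subset tight y ->
  exists I J, [/\ (I, J) \in Dset (nedges t),
    forall N, N \in NN -> (#|N :&: I| <= #|N :&: J|)%N &
    forall N, N \in NN' -> (#|N :&: J| <= #|N :&: I|)%N].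
Proof.
move=> [sx _] d0 [sxd xdN] [_ ydN] dv NN NN' nNN nNN'.
move=> /fintype.subsetP tx /fintype.subsetP ty.
apply: laminar_cone dv => //.
- exact: nesting_laminar.
- exact: nesting_laminar.
- move: sxd; rewrite -sum_setT -dot_indicator dotDl !dot_indicator !sum_setT sx.
  lra.
- move=> N /tx/tightP[nN xN]; have := xdN N nN.
  by rewrite -dot_indicator dotDl !dot_indicator xN lerDl.
- move=> N /ty/tightP[nN yN]; have := ydN N nN.
  by rewrite -dot_indicator dotBl !dot_indicator yN lerDl oppr_ge0.
Qed.

(* [x] minimizes [dot _ v] on the polytope intersected with its reflection in
   the midpoint of [x] and [y]. *)
Definition minimal x y : Prop := forall x', in_polytope x' ->
  in_polytope (x + y - x') -> dot x v <= dot x' v.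

Lemma minimal_Dset x y I J : in_polytope x -> in_polytope y -> minimal x y ->
    (I, J) \in Dset (nedges t) ->
    (forall N, N \in tight x -> (#|N :&: I| <= #|N :&: J|)%N) ->
    (forall N, N \in tight y -> (#|N :&: J| <= #|N :&: I|)%N) -> False.
Proof.
move=> xP yP minx IJD xI yI; pose d := indicator R J - indicator R I.
have dN N : \sum_(i in N) d 0 i = #|N :&: J|%:R - #|N :&: I|%:R.
  by rewrite -dot_indicator dotBl !dot_indicators.
have sumd : \sum_i d 0 i = 0.
  rewrite -sum_setT dN !finset.setTI; move: IJD; rewrite inE /=.
  by case/and3P=> /eqP -> _ _; rewrite subrr.
have [||a a0 [xa ya]] := in_polytope_move2 xP yP sumd.
- by move=> N /xI; rewrite dN subr_ge0 ler_nat.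
- by move=> N /yI; rewrite dN subr_le0 ler_nat.
have := minx _ xa; rewrite opprD addrACA subrr add0r => /(_ ya).
rewrite dotDl lerDl dotZl pmulr_rge0 // dotBl !indicator_dot subr_ge0.
by rewrite leNgt hv.
Qed.

(** A second minimizer would give a direction in the cone of the nestings tight at [x] and [y],
    hence a pair in [Dset] excluded by [minimal_Dset]. *)
Lemma minimal_unique x y x' : in_polytope x -> in_polytope y -> minimal x y ->
    in_polytope x' -> in_polytope (x + y - x') -> dot x' v <= dot x v -> x' = x.
Proof.
move=> xP yP minx x'P y'P le_x'; apply/eqP; rewrite -subr_eq0.
apply/negPn/negP => d0.
have [|||I [J [IJD xI yJ]]] := @cone_Dset x y (x' - x) xP d0 _ _ _
    _ _ (tight_nesting xP) (tight_nesting yP)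
    (fintype.subxx _) (fintype.subxx _).
- by rewrite addrC subrK.
- by rewrite opprB addrA [y + x]addrC.
- by rewrite dotBl subr_le0.
exact: minimal_Dset xP yP minx IJD xI yJ.
Qed.

Lemma reflectionE z x :
  reflection z (operahedron R w) x <-> in_polytope (2 *: z - x).
Proof.
split=> [[y /operahedronE yP <-]|zx].
  by rewrite opprB addrC subrK.
exists (2 *: z - x); first exact/operahedronE.
by rewrite opprB addrC subrK.
Qed.

(** It distinguishes true extremal points from the default value 0 of [bot_point] and
    [top_point]. *)
Lemma in_polytope_neq0 (e : E) x : in_polytope x -> x != 0.
Proof.
move=> [sumx _]; apply: contra_eq_neq sumx => ->.
under eq_bigr do rewrite mxE.
rewrite big1 // eq_sym gt_eqF // theta_gt0 //.
exact/nest_full/(leq_ltn_trans _ (ltn_ord e)).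
Qed.

(** The reflection exchanges minimizers and maximizers, so the mirror image of the top point is a
    minimizer; by uniqueness it is the bottom point. *)
Lemma polytope_diagonal_minimal z x y : x != 0 -> y != 0 ->
    polytope_diagonal (operahedron R w) v z = (x, y) ->
  [/\ in_polytope x, in_polytope y, x + y = 2 *: z & minimal x y].
Proof.
move=> x0 y0 []; rewrite /bot_point /top_point.
case: xgetP => [x1 _ [[/operahedronE xP /reflectionE zxP] minx] eqx|_ eqx];
  last by rewrite -eqx eqxx in x0.
case: xgetP => [y1 _ [[/operahedronE yP /reflectionE zyP] maxy] eqy|_ eqy];
  last by rewrite -eqy eqxx in y0.
rewrite {}eqx {}eqy {x1 y1} in xP zxP minx yP zyP maxy *.
have minx2 : minimal x (2 *: z - x).
  move=> x' x'P; rewrite [x + _]addrC subrK => zx'P; apply: minx.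
  by split; [exact/operahedronE | exact/reflectionE].
have zy : 2 *: z - y = x.
  apply: (minimal_unique xP zxP minx2) => //.
    by rewrite [x + _]addrC subrK opprB addrC subrK.
  have: dot (2 *: z - x) v <= dot y v.
    apply: maxy; split; first exact/operahedronE.
    by apply/reflectionE; rewrite opprB addrC subrK.
  by rewrite !dotBl !lerBlDr addrC.
have zx : 2 *: z - x = y by rewrite -zy opprB addrC subrK.
by rewrite zx in minx2; split=> //; rewrite -zy subrK.
Qed.

Lemma polytope_diagonal_cone NN NN' x y :
    is_nesting NN -> is_nesting NN' -> in_polytope x -> in_polytope y ->
    NN \subset tight x -> NN' \subset tight y ->
    (forall I J, (I, J) \in Dset (nedges t) ->
       (exists2 N, N \in NN & (#|N :&: J| < #|N :&: I|)%N) \/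
       (exists2 N, N \in NN' & (#|N :&: I| < #|N :&: J|)%N)) ->
  polytope_diagonal (operahedron R w) v (2^-1 *: (x + y)) = (x, y).
Proof.
move=> nNN nNN' xP yP xNN yNN' cond.
have dpos d : d != 0 -> in_polytope (x + d) -> in_polytope (y - d) ->
    0 < dot d v.
  move=> d0 xd yd; rewrite ltNge; apply/negP => dv.
  have [I [J [IJD xI yJ]]] :=
    cone_Dset xP d0 xd yd dv nNN nNN' xNN yNN'.
  have [[N /xI]|[N /yJ]] := cond I J IJD; by rewrite leqNgt => /negPf->.
have zE : 2 *: (2^-1 *: (x + y)) = x + y :> 'rV[R]_(nedges t).
  by rewrite scalerA divff ?pnatr_eq0 ?scale1r.
pose Q := (operahedron R w `&`
  reflection (2^-1 *: (x + y)) (operahedron R w))%classic.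
have xlt z : Q z -> z != x -> dot x v < dot z v.
  move=> [/operahedronE zP /reflectionE]; rewrite zE => zP' nezx.
  rewrite -subr_gt0 -dotBl dpos ?subr_eq0 //; first by rewrite addrC subrK.
  by rewrite opprB addrA [y + x]addrC.
have ylt z : Q z -> z != y -> dot z v < dot y v.
  move=> [/operahedronE zP /reflectionE]; rewrite zE => zP' nezy.
  rewrite -subr_gt0 -dotBl dpos ?subr_eq0 1?eq_sym //; first by rewrite addrA.
  by rewrite opprB addrC subrK.
have xQ : Q x.
  split; first exact/operahedronE.
  by apply/reflectionE; rewrite zE addrC addKr.
have yQ : Q y.
  split; first exact/operahedronE.
  by apply/reflectionE; rewrite zE addrK.
congr pair; apply: xget_unique.
- split=> // z zQ; have [->//|/(xlt _ zQ)] := eqVneq z x; exact: ltW.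
- move=> z [zQ /(_ _ xQ) minz]; apply/eqP/negPn/negP => /(xlt _ zQ).
  by rewrite ltNge minz.
- split=> // z zQ; have [->//|/(ylt _ zQ)] := eqVneq z y; exact: ltW.
- move=> z [zQ /(_ _ yQ) maxz]; apply/eqP/negPn/negP => /(ylt _ zQ).
  by rewrite ltNge maxz.
Qed.

End Diagonal.

End Operahedron.

(** * Products of faces in the image of the diagonal *)

Local Open Scope classical_set_scope.

Theorem theorem3p16 (R : realType) (t : ptree) (ht : wf_tree t)
    (w : 'I_(nvertices t) -> nat) (hw : forall x, 0 < w x)
    (v : 'rV[R]_(nedges t)) (hv : principal_orientation v)
    (F G : set 'rV[R]_(nedges t))
    (hF : is_face (operahedron R w) F) (hG : is_face (operahedron R w) G)
    (NN NN' : {set {set 'I_(nedges t)}})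
    (hNN : is_nesting NN) (hNN' : is_nesting NN')
    (hFN : F = nesting_face R w NN) (hGN : G = nesting_face R w NN') :
  (F `*` G `<=`
     polytope_diagonal (operahedron R w) v @` operahedron R w) <->
  (forall I J : {set 'I_(nedges t)}, (I, J) \in Dset (nedges t) ->
     (exists2 N, N \in NN & #|N :&: J| < #|N :&: I|) \/
     (exists2 N', N' \in NN' & #|N' :&: I| < #|N' :&: J|)).
Proof.
have faceE NN0 x : is_nesting NN0 -> nesting_face R w NN0 x <->
    in_polytope w x /\ NN0 \subset tight w x.
  by move=> nNN0; apply: nesting_faceE => // N; apply: nesting_nest.
rewrite {hF}hFN {hG}hGN; split=> [diag I J IJD|cond [x y]] /=.
  (* At these points every tight nest belongs to [NN], respectively [NN'], so a pair violating the
     condition gives a feasible descent direction. *)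
  pose x := generic_point R w NN; pose y := generic_point R w NN'.
  have face NN0 : is_nesting NN0 ->
      nesting_face R w NN0 (generic_point R w NN0).
    move=> nNN0; apply/faceE => //; split; first exact: generic_point_in.
    apply/fintype.subsetP => N NNN0; apply/tightP.
    by split; [exact: (nesting_nest nNN0) | exact: generic_point_eq].
  (* A pair in [Dset] provides an edge, which makes the points of the polytope nonzero. *)
  have e : 'I_(nedges t).
    by move: IJD; rewrite inE => /and3P[_ _ /existsP/sigW[]].
  have neq0 NN0 : is_nesting NN0 -> generic_point R w NN0 != 0%R.
    by move=> nNN0; apply: (in_polytope_neq0 hw e); apply: generic_point_in.
  have [z _ zxy] := diag (x, y) (conj (face _ hNN) (face _ hNN')).
  have [xP yP _ minx] :=
    polytope_diagonal_minimal hw hv (neq0 _ hNN) (neq0 _ hNN') zxy.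
  apply: contrapT => noN; apply: (minimal_Dset hv xP yP minx IJD) => N.
    move=> /(fintype.subsetP (tight_generic_point R hw hNN)) NNN.
    by rewrite leqNgt; apply/negP => ltN; apply: noN; left; exists N.
  move=> /(fintype.subsetP (tight_generic_point R hw hNN')) NNN.
  by rewrite leqNgt; apply/negP => ltN; apply: noN; right; exists N.
move=> [/(faceE _ _ hNN)[xP xNN] /(faceE _ _ hNN')[yP yNN']].
exists (2^-1 *: (x + y))%R; last first.
  exact: (polytope_diagonal_cone hw hv hNN hNN' xP yP xNN yNN' cond).
apply/operahedronE => //.
have -> : (2^-1 *: (x + y) = 2^-1 *: x + (1 - 2^-1) *: y)%R.
  by rewrite scalerDr; congr (_ + _ *: _)%R; field.
by apply: in_polytope_convex => //; lra.
Qed.
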